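(* Let $d$ be a positive integer and let $(G_n)_{n\ge 1}$ be a sequence of finite abelian groups with $|G_n|\to\infty$ as $n\to\infty$. Let $C_n$ be a uniformly random element of $\mathrm{Mat}_d(G_n)$. Suppose that $(\mu_{C_n})_{n\ge1}$ converges weakly in expectation. Then there exists a probability measure $\rho$ on $\mathbb{N}^*$ such that $\rho_{G_n}\to\rho$ weakly. Conversely, if $\rho$ is a probability measure on $\mathbb{N}^*$ and $\rho_{G_n}\to\rho$ weakly, then $\mu_{C_n}\to\mu$ weakly in expectation, where $$\mu=\sum_{m\in\mathbb{N}^*}\rho(\{m\})\,\eta_m^{*d}.$$
   Context: $\mathbb{N}=\{1,2,3,\dots\}$ and $\mathbb{N}^*=\mathbb{N}\cup\{\infty\}$ is the one-point compactification of $\mathbb{N}$ (discrete topology on $\mathbb{N}$). Measures are Borel measures. For a finite abelian group $G$ (written additively), a $G$-circulant matrix is a complex matrix $(A_{x,y})_{x,y\in G}$ of the form $A_{x,y}=a(x-y)$ for some function $a\colon G\to\mathbb{C}$. $\mathrm{Mat}_d(G)$ is the set of all $G$-circulant matrices with entries in $\{0,1\}$ and exactly $d$ ones in each row and column. This set is non-empty when $|G|\ge d$; $C_n$ is considered for those $n$ with $|G_n|\ge d$ (all sufficiently large $n$). For a square complex matrix $M$ of dimension $N$ with eigenvalues $\lambda_1(M),\dots,\lambda_N(M)$ (with algebraic multiplicity), $\mu_M=\frac1N\sum_{k=1}^N\delta_{\lambda_k(M)}$ is its empirical spectral distribution. If $M$ is random, $\mu_M$ is a random probability measure on $\mathbb{C}$.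 A sequence $(\mu_n)$ of random probability measures on $\mathbb{C}$ converges weakly in expectation to a (deterministic) probability measure $\mu$ on $\mathbb{C}$ if $\mathbb{E}\left[\int f\,d\mu_n\right]\to\int f\,d\mu$ for every bounded continuous $f\colon\mathbb{C}\to\mathbb{R}$; it converges weakly in expectation if it does so to some such $\mu$. For a finite abelian group $G$, $\rho_G=\frac{1}{|G|}\sum_{x\in G}\delta_{\mathrm{ord}_G(x)}$, regarded as a probability measure on $\mathbb{N}^*$, where $\mathrm{ord}_G(x)$ is the order of $x$ in $G$. For $m\in\mathbb{N}$, $\eta_m=\frac1m\sum_{k=1}^m\delta_{e^{2\pi i k/m}}$ is the uniform distribution on the $m$-th roots of unity, and $\eta_\infty$ is the uniform distribution on the unit circle in $\mathbb{C}$. $\eta_m^{*d}$ is the $d$-fold (additive) convolution of $\eta_m$ with itself on $\mathbb{C}$, i.e. the law of a sum of $d$ independent random variables with law $\eta_m$. *)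

(* Defs.v *)
From HB Require Import structures.
From mathcomp Require Import all_boot all_order all_algebra all_fingroup.
From mathcomp Require Import finmap complex.
From mathcomp Require Import all_classical all_reals all_analysis.
From mathcomp Require Import measurable_realfun lra.
Set Implicit Arguments.
Unset Strict Implicit.
Unset Printing Implicit Defensive.
Import Order.TTheory GRing.Theory Num.Theory.
Import numFieldTopology.Exports numFieldNormedType.Exports.
Local Open Scope classical_set_scope.
Local Open Scope ring_scope.

(* The topology of the modulus on R[i], i.e. the usual topology of C. *)
HB.instance Definition _ (R : rcfType) := PseudoPointedMetric.copy R[i] R[i]^o.
HB.instance Definition _ (R : rcfType) := NormedModule.copy R[i] R[i]^o.

Definition borel (T : ptopologicalType) := g_sigma_algebraType (@open T).
HB.instance Definition _ (T : ptopologicalType) := Measurable.on (borel T).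

Section weak_convergence.
Context (R : realType) (T : ptopologicalType).

Definition weak_cvg (mu_ : nat -> probability (borel T) R)
    (mu : probability (borel T) R) : Prop :=
  forall f : T -> R, continuous f -> bounded_fun f ->
    ((\int[mu_ n]_x (f x)%:E) @[n --> \oo] --> \int[mu]_x (f x)%:E)%E.

(* mu_ n is a random probability measure, defined on the probability space
   (Omega n, P n), which is allowed to vary with n. *)
Definition weak_cvg_in_expectation (disp : nat -> measure_display)
    (Omega : forall n, measurableType (disp n))
    (P : forall n, probability (Omega n) R)
    (mu_ : forall n, Omega n -> probability (borel T) R)
    (mu : probability (borel T) R) : Prop :=
  forall f : T -> R, continuous f -> bounded_fun f ->
    ((\int[P n]_w \int[mu_ n w]_x (f x)%:E) @[n --> \oo]
       --> \int[mu]_x (f x)%:E)%E.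

End weak_convergence.

Section empirical_measure.
Context d (T : measurableType d) (R : realType).

(* 1/N \sum_k \d_(s_k) with N = size s; repetitions in s count. *)
Definition empirical (s : seq T) : set T -> \bar R :=
  mscale ((size s)%:R^-1)%:nng (msum (fun k => \d_(nth point s k)) (size s)).

HB.instance Definition _ (s : seq T) := Measure.on (empirical s).

Lemma empirical_setT (s : seq T) : (0 < size s)%N -> empirical s setT = 1%E.
Proof.
move=> s0; rewrite /empirical /mscale/= /msum.
rewrite (eq_bigr (fun=> 1%E)); last by move=> i _; rewrite /= diracT.
rewrite sumEFin -EFinM sumr_const card_ord mulVf//.
by rewrite pnatr_eq0 -lt0n.
Qed.

End empirical_measure.

Section complex_borel.
Local Notation Re := complex.Re.
Local Notation Im := complex.Im.
Context (R : realType).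

Lemma open_complexE (U : set R[i]) (z : R[i]) : open U -> U z ->
  exists2 e : R, 0 < e & forall w : R[i],
    `|Re w - Re z| < e -> `|Im w - Im z| < e -> U w.
Proof.
rewrite openE => oU /oU /nbhs_ballP[e /= e0 zeU].
have [Ime Ree0] : Im e = 0 /\ 0 < Re e.
  by move: e0; rewrite ltcE/= => /andP[/eqP -> ->].
exists (Re e / 2); first by rewrite divr_gt0.
move=> w wz1 wz2; apply: zeU; rewrite /ball/=.
case: w z e Ime Ree0 wz1 wz2 {e0} => [a b] [c d] [e e'] /= -> e0 h1 h2.
apply/(@le_lt_trans _ _ (`|c - a| + `|d - b|)%:C%C).
  have -> : (c +i* d)%C - (a +i* b)%C = (c - a)%:C%C + (d - b)%:C%C * 'i%C.
    by simpc.
  apply: (le_trans (ler_normD _ _)); rewrite normrM.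
  by rewrite !normc_def/= !expr0n/= !addr0 !sqrtr_sqr expr1n add0r sqrtr1 mulr1 rmorphD.
by rewrite ltcR distrC [X in _ + X]distrC (splitr e) ltrD.
Qed.

Lemma measurable_complex d (T : measurableType d) (f : T -> borel R[i]) :
  measurable_fun setT (fun x => Re (f x : R[i])) ->
  measurable_fun setT (fun x => Im (f x : R[i])) ->
  measurable_fun setT f.
Proof.
move=> mRe mIm.
apply: (@measurability _ _ T (borel R[i]) setT f (@open R[i])) => //.
move=> _ [U oU <-]; rewrite setTI.
pose bx (i : rat * rat * nat) : set R[i] :=
  [set z | (Re z \in `]ratr i.1.1 - i.2.+1%:R^-1, ratr i.1.1 + i.2.+1%:R^-1[)
        /\ (Im z \in `]ratr i.1.2 - i.2.+1%:R^-1, ratr i.1.2 + i.2.+1%:R^-1[)].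
have -> : f @^-1` U = \bigcup_(i in [set i | bx i `<=` U]) (f @^-1` (bx i)).
  apply/seteqP; split=> [x /= Ux|x [i /= iU]]; last exact: iU.
  have [e e0 eU] := open_complexE oU Ux.
  have e20 : 0 < e / 2 by rewrite divr_gt0.
  pose n := Num.truncn (e / 2)^-1.
  have n0 : 0 < n.+1%:R^-1 :> R by rewrite invr_gt0.
  have ne : n.+1%:R^-1 < e / 2 :> R.
    by rewrite invf_plt ?posrE// truncnS_gt.
  have rP (y : R) : exists q : rat, (y < ratr q) && (ratr q < y + n.+1%:R^-1).
    have /rat_in_itvoo[q] : y < y + n.+1%:R^-1 by rewrite ltrDl.
    by rewrite in_itv/=; exists q.
  have [p pP] := rP (Re (f x : R[i])).
  have [q qP] := rP (Im (f x : R[i])).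
  have boxE (y s r t : R) : r < t / 2 -> y < s -> s < y + r ->
      s - r < y < s + r /\ forall v, s - r < v < s + r -> `|v - y| < t.
    move=> rt ys sy; split=> [|v /andP[v1 v2]]; first by apply/andP; split; lra.
    by rewrite ltr_norml; apply/andP; split; lra.
  move: pP qP => /andP[p1 p2] /andP[q1 q2].
  have [pb pe] := boxE _ _ _ _ ne p1 p2.
  have [qb qe] := boxE _ _ _ _ ne q1 q2.
  exists (p, q, n); last by rewrite /bx/= !in_itv.
  move=> w; rewrite /bx/= !in_itv/= => -[wp wq].
  by apply: eU; [exact: pe|exact: qe].
rewrite bigcup_mkcond; apply: countable_bigcupT_measurable => [|i]; first exact: countableP.
case: ifPn => // _.
have -> : f @^-1` bx i = ((fun x => Re (f x : R[i])) @^-1`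
    `]ratr i.1.1 - i.2.+1%:R^-1, ratr i.1.1 + i.2.+1%:R^-1[) `&`
  ((fun x => Im (f x : R[i])) @^-1`
    `]ratr i.1.2 - i.2.+1%:R^-1, ratr i.1.2 + i.2.+1%:R^-1[) by [].
by apply: measurableI; rewrite -[X in measurable X]setTI;
  [apply: mRe|apply: mIm].
Qed.

Lemma continuous_borel_measurable (T : ptopologicalType) (f : T -> R) :
  continuous f -> measurable_fun setT (f : borel T -> R).
Proof.
move=> /continuousP cf; apply: (measurability _ (RGenOpens.measurableE R)).
move=> _ [_ [a [b ->] <-]]; rewrite setTI.
by apply: sub_sigma_algebra; apply: cf; exact: interval_open.
Qed.

Lemma normc_ReIm (z : R[i]) : `|Re z|%:C%C <= `|z| /\ `|Im z|%:C%C <= `|z|.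
Proof.
split; first exact: normc_ge_Re.
have -> : `|z| = `|z * 'i%C| by rewrite normrM [X in _ * X]normc_def/= expr0n expr1n add0r sqrtr1 mulr1.
by have := normc_ge_Re (z * 'i%C); case: z => a b; simpc; rewrite /= normrN.
Qed.

Lemma continuous_Re : continuous (fun z : R[i] => Re z).
Proof.
move=> z A /nbhs_ballP[e /= e0 eA]; apply/nbhs_ballP.
exists e%:C%C => /=; first by rewrite ltcR.
move=> w; rewrite /ball/= => zw; apply: eA; rewrite /ball/= -ltcR.
apply: le_lt_trans zw.
by have [] := normc_ReIm (z - w); case: z w => [? ?] [? ?].
Qed.

Lemma continuous_Im : continuous (fun z : R[i] => Im z).
Proof.
move=> z A /nbhs_ballP[e /= e0 eA]; apply/nbhs_ballP.
exists e%:C%C => /=; first by rewrite ltcR.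
move=> w; rewrite /ball/= => zw; apply: eA; rewrite /ball/= -ltcR.
apply: le_lt_trans zw.
by have [] := normc_ReIm (z - w); case: z w => [? ?] [? ?].
Qed.

(* Addition of C, on a product carrying the product of the Borel
   sigma-algebras. *)
Definition cadd (z : borel R[i] * borel R[i]) : borel R[i] :=
  (z.1 : R[i]) + (z.2 : R[i]).

Lemma measurable_cadd : measurable_fun setT cadd.
Proof.
have mRe := continuous_borel_measurable continuous_Re.
have mIm := continuous_borel_measurable continuous_Im.
apply: measurable_complex.
  rewrite (_ : (fun _ => _) = (fun z : borel R[i] * borel R[i] => Re (z.1 : R[i]) + Re (z.2 : R[i]))).
    apply: measurable_funD.
      exact: measurableT_comp mRe measurable_fst.
    exact: measurableT_comp mRe measurable_snd.
  by apply/funext => -[[? ?] [? ?]].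
rewrite (_ : (fun _ => _) = (fun z : borel R[i] * borel R[i] => Im (z.1 : R[i]) + Im (z.2 : R[i]))).
  apply: measurable_funD.
    exact: measurableT_comp mIm measurable_fst.
  exact: measurableT_comp mIm measurable_snd.
by apply/funext => -[[? ?] [? ?]].
Qed.

HB.instance Definition _ :=
  isMeasurableFun.Build _ _ _ _ cadd measurable_cadd.

(* exp (i t), for t real. *)
Definition expi (t : R) : R[i] := (cos t +i* sin t)%C.

Definition circle_param (t : measurableTypeR R) : borel R[i] :=
  expi (2 * pi * (t : R)).

Lemma measurable_circle_param : measurable_fun setT circle_param.
Proof.
have mm : measurable_fun setT (fun t : R => 2 * pi * t) by exact: mulrl_measurable.
apply: measurable_complex => /=.
  exact: measurableT_comp (continuous_measurable_fun (@continuous_cos R)) mm.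
exact: measurableT_comp (continuous_measurable_fun (@continuous_sin R)) mm.
Qed.

HB.instance Definition _ :=
  isMeasurableFun.Build _ _ _ _ circle_param measurable_circle_param.

Definition convolution (P Q : probability (borel R[i]) R) :
    probability (borel R[i]) R :=
  distribution (P \x Q)%E cadd.

(* The 0-th convolution power is the Dirac mass at 0, the neutral element. *)
Definition conv_pow (P : probability (borel R[i]) R) (d : nat) :
    probability (borel R[i]) R :=
  iter d (convolution P) (@dirac _ (borel R[i]) (0 : R[i]) R).

End complex_borel.

Definition posnat := {n : nat | (0 < n)%N}.

(* None is the point at infinity. *)
Definition Nstar := one_point_compactification (discrete_topology posnat).
HB.instance Definition _ := PointedTopological.on Nstar.

Section roots_of_unity.
Context (R : realType).

Definition roots_law (m : nat) : set (borel R[i]) -> \bar R :=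
  empirical R [seq (expi (2 * pi * k%:R / m%:R) : borel R[i]) | k <- iota 1 m].

Section roots_law_probability.
Variable m : posnat.

HB.instance Definition _ := Measure.on (roots_law (sval m)).

Let roots_law_setT : roots_law (sval m) setT = 1%E.
Proof. by rewrite /roots_law empirical_setT// size_map size_iota (valP m). Qed.

HB.instance Definition _ :=
  Measure_isProbability.Build _ _ _ (roots_law (sval m)) roots_law_setT.

End roots_law_probability.

(* On m = oo: the law of exp (2 pi i t) for t uniform on [0, 1]. *)
Definition eta (m : Nstar) : probability (borel R[i]) R :=
  match m with
  | Some m => roots_law (sval (m : posnat))
  | None => distribution (uniform_prob (@ltr01 R)) (@circle_param R)
  end.

End roots_of_unity.

Section mixture.
Context (R : realType) (rho : probability (borel Nstar) R) (d : nat).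

Definition limit_law (A : set (borel R[i])) : \bar R :=
  (\esum_(m in [set: Nstar])
     rho ([set m] : set (borel Nstar)) * conv_pow (eta R m) d A)%E.

Let e (k : nat) : Nstar := if k is k'.+1 then Some (exist _ k'.+1 isT) else None.

Let e_bij : set_bij [set: nat] [set: Nstar] e.
Proof.
split => //.
- by move=> [|k] [|l] _ _ //= [->].
- move=> [[[|k] kP]|] _ //; last by exists 0%N.
  by exists k.+1 => //=; congr Some; apply: val_inj.
Qed.

Lemma measurable_Nstar1 (m : Nstar) : measurable ([set m] : set (borel Nstar)).
Proof.
have mS (k : discrete_topology posnat) :
    measurable ([set Some k] : set (borel Nstar)).
  apply: sub_sigma_algebra; rewrite -image_set1.
  exact/one_point_compactification_open_some/discrete_open.
case: m => [//|].
have -> : [set None] = ~` (\bigcup_k [set e k.+1]) :> set (borel Nstar).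
  apply/seteqP; split => [_ -> [k _] //|[x|] //= nx].
  case: nx; case: x => [[|k] kP] //; exists k => //=.
  by congr Some; apply: val_inj.
by apply: measurableC; apply: bigcupT_measurable => k; exact: mS.
Qed.

Let w (k : nat) : {nonneg R} :=
  NngNum (fine_ge0 (measure_ge0 rho ([set e k] : set (borel Nstar)))).

Let mu : {measure set (borel R[i]) -> \bar R} :=
  mseries (fun k => mscale (w k) (conv_pow (eta R (e k)) d)) 0.

Let wE k A : (rho ([set e k] : set (borel Nstar)) * conv_pow (eta R (e k)) d A =
  mscale (w k) (conv_pow (eta R (e k)) d) A)%E.
Proof.
transitivity (((w k)%:num)%:E * conv_pow (eta R (e k)) d A)%E; last by [].
by rewrite /w/= fineK// fin_num_measure//; exact: measurable_Nstar1.
Qed.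

Let limit_lawE : limit_law = mu.
Proof.
apply/funext => A; rewrite /limit_law (@reindex_esum R _ _ _ _ _ _ e_bij).
transitivity (\sum_(0 <= k <oo) mscale (w k) (conv_pow (eta R (e k)) d) A)%E.
  by rewrite nneseries_esumT//; apply: eq_esum => k _; exact: wE.
by [].
Qed.

Let limit_law0 : limit_law set0 = 0%E.
Proof. by rewrite limit_lawE measure0. Qed.

Let limit_law_ge0 A : (0 <= limit_law A)%E.
Proof. by rewrite limit_lawE. Qed.

Let limit_law_sigma_additive : semi_sigma_additive limit_law.
Proof. by rewrite limit_lawE; exact: measure_semi_sigma_additive. Qed.

HB.instance Definition _ := isMeasure.Build _ _ _ limit_law
  limit_law0 limit_law_ge0 limit_law_sigma_additive.

Let limit_law_setT : limit_law setT = 1%E.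
Proof.
rewrite limit_lawE.
transitivity (\sum_(0 <= k <oo) mscale (w k) (conv_pow (eta R (e k)) d) setT)%E.
  by [].
rewrite -(probability_setT rho).
have -> : [set: borel Nstar] = \bigcup_k [set e k].
  apply/seteqP; split => // x _.
  by have [_ _ /(_ x I)[k _ <-]] := e_bij; exists k.
rewrite measure_bigcup//=; last 2 first.
- by move=> k _; exact: measurable_Nstar1.
- by move=> i j _ _ [x [-> /esym eij]]; have [_ + _] := e_bij; apply; rewrite ?inE//.
rewrite [RHS]eseries_mkcond; apply: eq_eseriesr => k _.
by rewrite in_setT -wE probability_setT mule1.
Qed.

HB.instance Definition _ :=
  Measure_isProbability.Build _ _ _ limit_law limit_law_setT.

End mixture.

Section esd.
Context (R : realType).
Local Notation C := R[i].

(* The roots of the characteristic polynomial, with multiplicity. *)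
Definition eigenvalues n (M : 'M[C]_n) : seq C :=
  sval (closed_field_poly_normal (char_poly M)).

Lemma size_eigenvalues n (M : 'M[C]_n) : size (eigenvalues M) = n.
Proof.
rewrite /eigenvalues; case: closed_field_poly_normal => /= r.
rewrite (monicP (char_poly_monic M)) scale1r => rE.
by have := size_char_poly M; rewrite rE size_prod_XsubC => -[].
Qed.

Definition esd n (M : 'M[C]_n) : set (borel C) -> \bar R :=
  empirical R (eigenvalues M : seq (borel C)).

HB.instance Definition _ n (M : 'M[C]_n) := Measure.on (esd M).

End esd.

Section circulant.
Context (R : realType) (G : finZmodType).
Local Notation C := R[i].

(* Rows and columns are indexed by G through enum_val. *)
Definition circulant (A : 'M[C]_#|G|) : Prop :=
  exists a : G -> C, forall i j, A i j = a (enum_val i - enum_val j).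

Definition Mat (d : nat) : set 'M[C]_#|G| :=
  [set A | [/\ circulant A,
               forall i j, A i j = 0 \/ A i j = 1,
               forall i, #|[set j | A i j == 1]%SET| = d &
               forall j, #|[set i | A i j == 1]%SET| = d]].

Lemma finite_Mat d : finite_set (Mat d).
Proof.
pose F (f : {ffun 'I_#|G| * 'I_#|G| -> bool}) : 'M[C]_#|G| :=
  \matrix_(i, j) (f (i, j))%:R.
apply: (@sub_finite_set _ _ (range F)); last first.
  exact: finite_image.
move=> A [_ A01 _ _]; exists [ffun p => A p.1 p.2 == 1] => //.
apply/matrixP => i j; rewrite mxE ffunE/=.
by case: (A01 i j) => ->; rewrite ?eqxx// eq_sym oner_eq0.
Qed.

Let card_gt0 : (0 < #|G|)%N.
Proof. by apply/card_gt0P; exists 0. Qed.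

Let esd_setT (M : 'M[C]_#|G|) : esd M setT = 1%E.
Proof. by rewrite /esd empirical_setT// size_eigenvalues. Qed.

HB.instance Definition _ (M : 'M[C]_#|G|) :=
  Measure_isProbability.Build _ _ _ (esd M) (esd_setT M).

Definition ord_law : set (borel Nstar) -> \bar R :=
  empirical R [seq (Some (exist _ #[x]%g (order_gt0 x) : posnat) : borel Nstar)
              | x <- enum G].

HB.instance Definition _ := Measure.on ord_law.

Let ord_law_setT : ord_law setT = 1%E.
Proof. by rewrite /ord_law empirical_setT// size_map -cardE. Qed.

HB.instance Definition _ :=
  Measure_isProbability.Build _ _ _ ord_law ord_law_setT.

End circulant.

(* X is uniformly distributed on the finite set A; fset_set A is A itself as
   a finite set, provided A is finite. *)
Definition uniform_on (R : realType) d (Omega : measurableType d)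
    (P : probability Omega R) (T : choiceType) (X : Omega -> T) (A : set T) :
    Prop :=
  (forall w, A (X w)) /\
  (forall a, A a -> measurable (X @^-1` [set a]) /\
                    P (X @^-1` [set a]) = ((#|` fset_set A |%fset%:R)^-1)%:E).

(* Main.v *)
Require Import Defs.
From HB Require Import structures.
From mathcomp Require Import all_boot all_order all_algebra all_fingroup.
From mathcomp Require Import all_solvable.
From mathcomp Require Import finmap complex.
From mathcomp Require Import all_classical all_reals all_analysis.
From mathcomp Require Import measurable_realfun ring lra zify.
Set Implicit Arguments.
Unset Strict Implicit.
Unset Printing Implicit Defensive.
Import Order.TTheory GRing.Theory Num.Theory.
Import numFieldTopology.Exports numFieldNormedType.Exports.
Local Open Scope classical_set_scope.
Local Open Scope ring_scope.

(** Let [S] be a random [d]-subset of a finite abelian group [G].  The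
    characters of [G] diagonalise every circulant matrix, so the eigenvalues
    of the matrix attached to [S] are the sums of [chi s] over [s] in [S].
    Replacing [S] by [d] independent uniform points of [G] changes the
    expectation of a bounded function by [O(d^2/#|G|)] ([sampling_dist]), and
    for independent points [chi s] is uniform on the roots of unity of order
    [ord chi] ([sum_comp_bicharacter]).  Since [G] is isomorphic to its dual,
    characters of a given order are as many as elements of that order; this
    is used in the form of a symmetric nondegenerate pairing of [G] with itself
    ([exists_bicharacter]), obtained from the decomposition of [G] into cyclic
    factors.  Hence, up to a vanishing error, the expected integral of [f] is
    the integral over [ord_law G] of
      [F m] = the integral of [f] for the [d]-th convolution power of [eta m]
    ([expected_esd_dist]).  In the code [F] is [law_avg d f], the [d]-fold
    iterate at 0 of the averaging operator of [eta m].

    The function [F] is continuous on [Nstar].  Indeed the [m]-th roots of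
    unity are the image of a uniform point [t] of [0, 1] rounded down to a
    multiple of [1/m], so dominated convergence applies; to get through the
    [d] iterations one proves that the averages converge along every
    convergent sequence of base points ([iter_shift_avg_cvg]).  Therefore weak
    convergence of [ord_law (G n)] to [rho] gives convergence of the expected
    spectral distributions to the mixture [limit_law rho d]
    ([limit_law_integral]).

    Conversely, suppose that the integrals of all [F] converge.  Take for [f] a
    bounded function that agrees with the real part of [z ^ k] on the disc of
    radius [d].  The [k]-th moment of the sum of [d] uniform [m]-th roots of
    unity vanishes unless [m] divides [k] and equals [d] when [m = k]
    ([moment_ndvd], [moment_order]), so the integral of [F] is a triangular
    combination of the masses of [ord_law (G n)] at [1, ..., k]
    ([integral_power_ord_law]).  By induction on [k] the mass at each finite
    point converges ([cvg_mass_of_power_tests]).  The limits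
    have total at most 1, the rest is put at infinity
    ([exists_prob_mass]), and convergence of the masses at the finite points
    is enough for weak convergence on [Nstar] ([weak_cvg_mass]), because a
    continuous function on [Nstar] is nearly constant near infinity. *)

(** * Roots of unity and perfect pairings of finite abelian groups *)

Section roots.
Variable R : realType.
Local Notation C := R[i].

Lemma expiD (s t : R) : expi (s + t) = expi s * expi t.
Proof. by rewrite /expi cosD sinD; simpc; congr (_ +i* _)%C; rewrite addrC. Qed.

Lemma expi0 : expi 0 = 1 :> C.
Proof. by rewrite /expi cos0 sin0. Qed.

Lemma expiX (t : R) n : expi (t * n%:R) = expi t ^+ n.
Proof.
elim: n => [|n ih]; first by rewrite mulr0 expi0.
by rewrite -natr1 mulrDr mulr1 expiD ih exprSr.
Qed.

Lemma normr_expi (t : R) : `|expi t| = 1 :> C.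
Proof. by rewrite normc_def/= cos2Dsin2 sqrtr1. Qed.

Definition omega (m : nat) : C := expi (2 * pi / m%:R).

Lemma omegaX (m k : nat) : expi (2 * pi * k%:R / m%:R) = omega m ^+ k.
Proof. by rewrite -expiX; congr expi; rewrite mulrAC. Qed.

(** If a smaller positive power [k] gave 1, then [cos (2 y) = 1] with
    [y = pi k / m] in the open interval from 0 to [pi], where the sine is positive. *)
Lemma omega_prim m : (0 < m)%N -> m.-primitive_root (omega m).
Proof.
have aux (s : R) : (1 - s) *+ 2 - 1 = 1 -> s = 0.
  by rewrite -mulr_natr => h; lra.
move=> m0; apply/andP; split => //; apply/forallP => i; apply/eqP.
rewrite unity_rootE -omegaX.
have [->|im] := eqVneq i.+1 m.
  rewrite mulfK ?pnatr_eq0 -?lt0n // /expi.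
  by rewrite mulr_natl cos2pi sin2pi eqxx.
apply/eqP => /(congr1 (@complex.Re R)) /= h.
have im' : (i.+1 < m)%N by rewrite ltn_neqAle im ltn_ord.
pose y : R := pi * i.+1%:R / m%:R.
have y0 : 0 < y by rewrite /y !mulr_gt0 ?pi_gt0 ?invr_gt0 ?ltr0n.
have y1 : y < pi.
  by rewrite /y ltr_pdivrMr ?ltr0n// ltr_pM2l ?pi_gt0// ltr_nat.
have := @sin_gt0_pi R y; rewrite y0 y1 => /(_ isT) s0.
have e : 2 * pi * i.+1%:R / m%:R = y *+ 2.
  by rewrite -[RHS]mulr_natl /y !mulrA.
move: h; rewrite e cos_mulr2n cos2sin2 => h.
have : 0 < sin y ^+ 2 by rewrite exprn_gt0.
by rewrite (aux _ h) ltxx.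
Qed.

End roots.

Section pairing.
Variable R : realType.
Local Notation C := R[i].
Local Open Scope group_scope.
Import GroupScope.

(** Symmetry makes multiplicativity in one variable sufficient. *)
Definition perfect_pairing (gT : finGroupType) (G : {set gT})
    (b : gT -> gT -> C) : Prop :=
  [/\ forall x y, b x y = b y x,
      {in G & G, forall x x' y, b (x * x') y = (b x y * b x' y)%R},
      forall y, b 1%g y = 1%R &
      {in G, forall x, {in G, forall y, b x y = 1%R} -> x = 1}].

(** On a cyclic factor of order [n] with generator [g], the pairing is
    [(g^i, g^j) |-> omega n ^ (i j)]; a direct product gets the product of the
    pairings of its factors.  Testing against [g], and then against the other
    factor, gives nondegeneracy. *)
Lemma pairing_dprod (gT : finGroupType) (s : seq gT) (G : {group gT}) :
  \big[dprod/1]_(x <- s) <[x]> = G -> exists b, perfect_pairing G b.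
Proof.
elim: s G => [|g s ih] G.
  rewrite big_nil => <-; exists (fun _ _ => 1%R); split => //.
    by move=> *; rewrite mulr1.
  by move=> x /set1P.
rewrite big_cons => dG; have [[K H Kg Hs] _ _ _] := dprodP dG.
rewrite Hs in dG; have {Hs}[b [bC bM b1 bnd]] := ih H Hs.
have {Kg} dG : <[g]> \x H = G by [].
have [_ defG cgH tigH] := dprodP dG.
(* thanks to this complement the projections onto the two factors are morphisms *)
have cmpl : H \in [complements to <[g]> in G] by apply/complP; split.
have nsg : normal <[g]> G.
  by rewrite -defG -cent_joinEr // normalYl cents_norm.
pose n := #[g].
pose lg u : nat := odflt 0%N (omap (@nat_of_ord n) [pick i : 'I_n | g ^+ i == u]).
have lgE u : u \in <[g]> -> g ^+ lg u = u.
  move=> /cyclePmin [i ilt ->]; rewrite /lg; case: pickP => [j /eqP//|].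
  by move=> /(_ (Ordinal ilt)); rewrite /= eqxx.
have n0 : (0 < n)%N by exact: order_gt0.
have zp := omega_prim R n0.
have lgM u v : u \in <[g]> -> v \in <[g]> -> lg (u * v) = lg u + lg v %[mod n].
  move=> ug vg; apply/eqP; rewrite -eq_expg_mod_order expgD !lgE//.
  by rewrite groupM.
have zM u v k : u \in <[g]> -> v \in <[g]> ->
    (omega R n ^+ (lg (u * v)%g * k) =
     omega R n ^+ (lg u * k) * omega R n ^+ (lg v * k))%R.
  move=> ug vg; rewrite -exprD -mulnDl; apply/eqP.
  by rewrite (eq_prim_root_expr zp) -modnMml lgM// modnMml.
pose p1 := divgr <[g]> H; pose p2 := remgr <[g]> H.
have p1G x : x \in G -> p1 x \in <[g]> by rewrite -defG; exact: mem_divgr.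
have p2G x : x \in G -> p2 x \in H by rewrite -defG; exact: mem_remgr.
have p1g x y : x \in <[g]> -> y \in H -> p1 (x * y) = x by exact: divgrMid.
have p2g x y : x \in <[g]> -> y \in H -> p2 (x * y) = y by exact: remgrMid.
have p12 x : x = p1 x * p2 x by exact: divgr_eq.
have p1M : {in G &, {morph p1 : x y / x * y}} by exact: divgrM.
have p2M : {in G &, {morph p2 : x y / x * y}} by exact: remgrM.
clearbody p1 p2.
have lg1 : (n %| lg 1%g)%N by rewrite order_dvdn lgE// group1.
exists (fun x y => (omega R n ^+ (lg (p1 x) * lg (p1 y)) * b (p2 x) (p2 y))%R).
split.
- by move=> x y; rewrite mulnC bC.
- move=> x x' Gx Gx' y; rewrite p1M// p2M//.
  by rewrite bM ?p2G// zM ?p1G// mulrACA.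
- move=> y; rewrite -{1 2}(mulg1 1) p1g// p2g// b1 mulr1.
  by apply/eqP; rewrite -(prim_order_dvd zp) dvdn_mulr.
- move=> x Gx h.
  have gG : g \in G by rewrite -defG (fintype.subsetP (mulG_subl _ _))// cycle_id.
  have p1x : p1 x = 1.
    have := h _ gG; rewrite -{1 2}[g]mulg1 p1g ?cycle_id// p2g ?cycle_id//.
    rewrite bC b1 mulr1 => /eqP; rewrite -(prim_order_dvd zp).
    rewrite /dvdn -modnMmr.
    have -> : (lg g = 1 %[mod n])%N.
      by apply/eqP; rewrite -eq_expg_mod_order lgE ?expg1 ?cycle_id.
    by rewrite modnMmr muln1 -/(dvdn _ _) order_dvdn lgE ?p1G// => /eqP.
  have p2x : p2 x = 1.
    apply: bnd => [|y Hy]; first exact: p2G.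
    have Gy : y \in G by rewrite -defG (fintype.subsetP (mulG_subr _ _)).
    have := h _ Gy; rewrite -{1 2}[y]mul1g p1g// p2g// p1x => <-.
    rewrite -[LHS]mul1r; congr (_ * _)%R; apply/esym/eqP.
    by rewrite -(prim_order_dvd zp) dvdn_mulr.
  by rewrite (p12 x) p1x p2x mulg1.
Qed.

End pairing.

(** * Characters: orthogonality, equidistribution, circulant spectra *)

Section bicharacter.
Variables (R : realType) (G : finZmodType).
Local Notation C := R[i].

(** Self-duality of a finite abelian group: the characters are the [b x], and
    the character [b x] has the order of [x]. *)
Lemma exists_bicharacter : exists b : G -> G -> C,
  [/\ forall x y, b x y = b y x,
      forall x x' y, b (x + x') y = b x y * b x' y,
      forall y, b 0 y = 1 &
      forall x, (forall y, b x y = 1) -> x = 0].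
Proof.
have [s sG _] := abelian_structure (FinRing.zmod_abelian [set: G]).
have [b [bC bD b0 bnd]] := pairing_dprod R sG.
exists b; split => //.
- by move=> x x' y; apply: bD; rewrite finset.in_setT.
- by move=> x h; apply: bnd => //; rewrite finset.in_setT.
Qed.

Variable b : G -> G -> C.
Hypothesis bC : forall x y, b x y = b y x.
Hypothesis bDl : forall x x' y, b (x + x') y = b x y * b x' y.
Hypothesis b0l : forall y, b 0 y = 1.
Hypothesis bnd : forall x, (forall y, b x y = 1) -> x = 0.

Let bDr x y y' : b x (y + y') = b x y * b x y'.
Proof. by rewrite bC bDl !(bC _ x). Qed.

Let bMnl x k y : b (x *+ k) y = b x y ^+ k.
Proof.
by elim: k => [|k ih]; [rewrite b0l|rewrite mulrS bDl ih exprS].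
Qed.

(** Translating the summation index by [z] multiplies the sum by [b x z], which
    differs from 1 for some [z] when [x != 0]. *)
Lemma sum_bicharacter x : \sum_y b x y = if x == 0 then #|G|%:R else 0.
Proof.
case: eqP => [->|/eqP x0].
  by rewrite (eq_bigr (fun=> 1)) ?sumr_const// => y _; rewrite b0l.
have [z bz] : exists z, b x z != 1.
  apply: contrapT => /forallNP h; move/eqP: x0; apply; apply: bnd => y.
  by apply/eqP/negPn/negP; exact: h.
have : (b x z - 1) * \sum_y b x y = 0.
  rewrite mulrBl mul1r mulr_sumr [X in _ - X](reindex_inj (addrI z)) /=.
  by apply/eqP; rewrite subr_eq0; apply/eqP/eq_bigr => y _; rewrite bDr.
by move/eqP; rewrite mulf_eq0 subr_eq0 (negbTE bz) => /eqP.
Qed.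

(** Counting by Fourier inversion on the group of roots of unity: the indicator
    of [b x y = zeta] is the average over [j] of [(b x y / zeta)^j], and only
    [j = 0] survives the summation over [y]. *)
Lemma card_bicharacter_fiber x k :
  (#|[set y | b x y == omega R #[x]%g ^+ k]%SET| * #[x]%g = #|G|)%N.
Proof.
set m := #[x]%g; have m0 : (0 < m)%N := order_gt0 x.
have zp := omega_prim R m0.
have z0 : omega R m != 0 by rewrite -normr_eq0 normr_expi oner_eq0.
have bm y : b x y ^+ m = 1 by rewrite -bMnl -FinRing.zmodXgE expg_order.
apply/eqP; rewrite -(eqr_nat C) natrM; apply/eqP.
transitivity (\sum_y \sum_(j < m) (b x y * (omega R m ^- k)) ^+ j).
  rewrite -sum1_card natr_sum mulr_suml big_mkcond/=; apply: eq_bigr => y _.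
  rewrite inE; have [->|h] := eqVneq.
    rewrite mul1r mulfV ?expf_neq0//.
    by under eq_bigr do rewrite expr1n; rewrite sumr_const card_ord.
  have := subrX1 (b x y * omega R m ^- k) m.
  rewrite exprMn bm mul1r exprVn -exprM mulnC exprM (prim_expr_order zp).
  rewrite expr1n invr1 subrr => /esym/eqP; rewrite mulf_eq0 => /orP[|/eqP//].
  rewrite subr_eq0 => /eqP h'; case/eqP: h.
  by rewrite -[LHS](divfK (expf_neq0 k z0)) h' mul1r.
rewrite exchange_big /= (bigD1 (Ordinal m0))//= [X in _ + X]big1 ?addr0 => [|j j0].
  by under eq_bigr do rewrite expr0; rewrite sumr_const.
under eq_bigr do rewrite exprMn -bMnl.
rewrite -mulr_suml sum_bicharacter ifF ?mul0r//.
apply/negbTE; rewrite -FinRing.zmodXgE -order_dvdn -/m; apply: contra j0 => jm.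
by apply/eqP/val_inj => /=; apply/eqP; rewrite -[_ == _]negbK -lt0n;
  apply/negP => j0; have := dvdn_leq j0 jm; rewrite leqNgt ltn_ord.
Qed.

(** All fibres of the character [b x] over the roots of unity of order [#[x]]
    have the same cardinal. *)
Lemma sum_comp_bicharacter x (g : C -> R) :
  #|G|%:R^-1 * \sum_y g (b x y) =
  (#[x]%g)%:R^-1 * \sum_(k < #[x]%g) g (omega R #[x]%g ^+ k).
Proof.
set m := #[x]%g; have m0 : (0 < m)%N := order_gt0 x.
have G0 : #|G|%:R != 0 :> R.
  by rewrite pnatr_eq0 -lt0n; apply/card_gt0P; exists 0.
have zp := omega_prim R m0.
(* group the [y] by the value of the character *)
transitivity (#|G|%:R^-1 * \sum_y \sum_(k < m)
    (if b x y == omega R m ^+ k then g (omega R m ^+ k) else 0)).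
  congr (_ * _); apply: eq_bigr => y _.
  have : b x y ^+ m = 1 by rewrite -bMnl -FinRing.zmodXgE expg_order.
  move/(prim_rootP zp) => [i ->].
  rewrite (bigD1 i)//= eqxx big1 ?addr0// => j ji; rewrite ifF//.
  apply: contraNF ji; rewrite (eq_prim_root_expr zp) !modn_small// => /eqP ij.
  by apply/eqP/val_inj.
rewrite exchange_big /= !mulr_sumr; apply: eq_bigr => k _.
rewrite -?mulr_sumr -big_mkcond sumr_const.
rewrite -[X in _ * X]mulr_natl mulrA; congr (_ * _).
have /(congr1 (fun n => n%:R : R)) := card_bicharacter_fiber x k.
rewrite natrM -/m cardsE => h; move: G0; rewrite -h mulf_eq0 negb_or => /andP[n0 _].
by rewrite invfM mulrAC mulVf ?mul1r.
Qed.

Let bigE (T : Type) (idx : T) (op : Monoid.com_law idx) (F : G -> T) :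
  \big[op/idx]_(i < #|G|) F (enum_val i) = \big[op/idx]_x F x.
Proof. by rewrite -big_enum_val; apply: eq_bigl => x; rewrite inE. Qed.

(** The columns [i |-> b x (- i)] of the Fourier matrix [F] are eigenvectors, and
    [F] is invertible by orthogonality of the characters. *)
Lemma char_poly_circulant (A : 'M[C]_#|G|) (a : G -> C) :
  (forall i j, A i j = a (enum_val i - enum_val j)) ->
  char_poly A = \prod_x ('X - (\sum_s a s * b x s)%:P).
Proof.
move=> Aa.
pose l x := \sum_s a s * b x s.
pose F : 'M[C]_#|G| := \matrix_(i, k) b (enum_val k) (- enum_val i).
pose F' : 'M[C]_#|G| := \matrix_(k, j) b (enum_val k) (enum_val j).
pose D : 'M[C]_#|G| := diag_mx (\row_k l (enum_val k)).
have FF' : F *m F' = #|G|%:R%:M.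
  apply/matrixP => i j; rewrite !mxE.
  under eq_bigr do rewrite !mxE -bDr.
  rewrite (bigE _ (fun z => b z (- enum_val i + enum_val j))) /=.
  under eq_bigr do rewrite bC.
  rewrite sum_bicharacter addrC subr_eq0 (inj_eq enum_val_inj) eq_sym.
  by case: eqP.
have G0 : #|G|%:R != 0 :> C.
  by rewrite pnatr_eq0 -lt0n; apply/card_gt0P; exists 0.
have detF : \det F != 0.
  have := congr1 determinant FF'; rewrite det_mulmx det_scalar => h.
  by have := expf_neq0 #|G| G0; rewrite -h mulf_eq0 negb_or => /andP[].
have AF : A *m F = F *m D.
  apply/matrixP => i k; rewrite mul_mx_diag !mxE.
  under eq_bigr do rewrite Aa !mxE.
  rewrite (bigE _ (fun z => a (enum_val i - z) * b (enum_val k) (- z))) /=.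
  rewrite (reindex_inj (inv_inj (fun z => subKr (enum_val i) z))) /=.
  rewrite /l mulr_sumr; apply: eq_bigr => s _.
  by rewrite subKr opprB bDr mulrC -mulrA mulrC mulrA.
have : char_poly A * (\det F)%:P = char_poly D * (\det F)%:P.
  rewrite /char_poly -det_map_mx -det_mulmx [RHS]mulrC -det_mulmx.
  congr (\det _); rewrite /char_poly_mx mulmxBl mulmxBr -!map_mxM AF.
  by rewrite scalar_mxC.
move/(mulIf _) => -> //; last by rewrite polyC_eq0.
rewrite char_poly_trig; last first.
  by apply: diag_mx_is_trig.
rewrite -(bigE _ (fun x => 'X - (l x)%:P)) /=.
by apply: eq_bigr => i _; rewrite !mxE eqxx.
Qed.

End bicharacter.

(** * Sampling with and without replacement *)

Section sampling.
Variables (R : realType) (G : finType).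

Lemma ffact_le_expn N d : (N ^_ d <= N ^ d)%N.
Proof.
by elim: d => // d ih; rewrite ffactnSr expnSr leq_mul// leq_subr.
Qed.

(** A union bound for the probability of a collision among [d] independent
    uniform draws from [N] elements. *)
Lemma ffact_ratio_ge (N d : nat) : (0 < N)%N ->
  1 - (d ^ 2)%:R / N%:R <= (N ^_ d)%:R / (N ^ d)%:R :> R.
Proof.
move=> N0; have N0' : 0 < N%:R :> R by rewrite ltr0n.
elim: d => [|d ih]; first by rewrite ffactn0 expn0 mul0r subr0 divr1.
pose p : R := (N ^_ d)%:R / (N ^ d)%:R; pose q : R := (N - d)%:R / N%:R.
have -> : (N ^_ d.+1)%:R / (N ^ d.+1)%:R = p * q.
  by rewrite ffactnSr expnSr !natrM invfM mulrACA.
have p1 : p <= 1.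
  by rewrite /p ler_pdivrMr ?ltr0n ?expn_gt0 ?N0// mul1r ler_nat ffact_le_expn.
have p0 : 0 <= p by rewrite divr_ge0.
have q1 : 1 - d%:R / N%:R <= q.
  rewrite -[X in X - _](divff (lt0r_neq0 N0')) -mulrBl ler_pM2r ?invr_gt0//.
  have [dN|Nd] := leqP d N; first by rewrite natrB.
  by rewrite (@le_trans _ _ 0)// subr_le0 ler_nat ltnW.
have q1' : q <= 1 by rewrite ler_pdivrMr// mul1r ler_nat leq_subr.
have -> : (d.+1 ^ 2)%:R / N%:R = (d ^ 2)%:R / N%:R + d%:R / N%:R + d.+1%:R / N%:R :> R.
  rewrite -!mulrDl -!natrD; congr (_%:R / _); lia.
have h : 0 <= d.+1%:R / N%:R :> R by rewrite divr_ge0.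
move: ih; rewrite -/p; clearbody p q; move: (_ / _) => a.
move: q1 h; move: (_ / _) => u; move: (_ / _) => v.
move=> *; have : 0 <= (1 - p) * (1 - q) by rewrite mulr_ge0 ?subr_ge0.
have -> : (1 - p) * (1 - q) = 1 - p - q + p * q by ring.
lra.
Qed.

Lemma big_tupleS (V : zmodType) n (F : n.+1.-tuple G -> V) :
  \sum_(t : n.+1.-tuple G) F t = \sum_y \sum_(t : n.-tuple G) F [tuple of y :: t].
Proof.
rewrite pair_big /= (reindex (fun p : G * n.-tuple G => [tuple of p.1 :: p.2])) //=.
exists (fun t => (thead t, [tuple of behead t])) => [[y t] _|t _] /=.
  by congr pair; apply: val_inj.
by rewrite [RHS]tuple_eta.
Qed.

(** A repetition-free tuple of length [#|S|] with entries in [S] exhausts [S]. *)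
Lemma card_uniq_tuples_set d (S : {set G}) : #|S| = d ->
  #|[set t : d.-tuple G | uniq t & [set x in t]%SET == S]%SET| = d`!.
Proof.
move=> Sd; rewrite -ffactnn -[X in (X ^_ _)%N]Sd -card_uniq_tuples.
apply: eq_card => t; rewrite !inE; have [ut|_] /= := boolP (uniq t); last by rewrite andbF.
rewrite andbT.
apply/eqP/allP => [<- x xt|h].
  by change (x \in [set x0 in t]%SET); rewrite inE.
apply/eqP; rewrite eqEcard; apply/andP; split.
  by apply/fintype.subsetP => x; rewrite inE => /h.
by rewrite cardsE (card_uniqP ut) size_tuple Sd.
Qed.

Lemma sum_uniq_tuples (V : zmodType) d (psi : {set G} -> V) :
  \sum_(t : d.-tuple G | uniq t) psi [set x in t]%SET =
  (\sum_(S : {set G} | #|S| == d) psi S) *+ d`!.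
Proof.
rewrite (partition_big (fun t : d.-tuple G => [set x in t]%SET)
  (fun S => #|S| == d)) /=; last first.
  by move=> t ut; rewrite cardsE (card_uniqP ut) size_tuple.
rewrite -sumrMnl; apply: eq_bigr => S /eqP Sd.
rewrite (eq_bigr (fun=> psi S)) => [|t /andP[_ /eqP->]//].
rewrite -(card_uniq_tuples_set Sd) -sumr_const; apply: eq_bigl => t.
by rewrite inE.
Qed.

(** A uniform [d]-subset is the image of a uniform repetition-free tuple, since
    each subset has [d!] orderings; conditioning a tuple on having no repetition
    costs twice the probability of a collision. *)
Lemma sampling_dist d (psi : seq G -> R) (M : R) :
  (0 < #|G|)%N -> (d <= #|G|)%N -> (forall s, `|psi s| <= M) ->
  (forall s t, perm_eq s t -> psi s = psi t) ->
  `| #|[set S : {set G} | #|S| == d]%SET|%:R^-1 *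
       \sum_(S in [set S : {set G} | #|S| == d]%SET) psi (enum S) -
     (#|G| ^ d)%:R^-1 * \sum_(t : d.-tuple G) psi t |
  <= 2 * M * ((d ^ 2)%:R / #|G|%:R).
Proof.
move=> G0 dG psiM psiP; set N := #|G|.
have M0 : 0 <= M by rewrite (le_trans _ (psiM [::])).
pose A := \sum_(t : d.-tuple G | uniq t) psi t.
pose B := \sum_(t : d.-tuple G | ~~ uniq t) psi t.
pose U : R := (N ^_ d)%:R; pose T : R := (N ^ d)%:R.
have U0 : 0 < U by rewrite ltr0n ffact_gt0.
have T0 : 0 < T by rewrite ltr0n expn_gt0 G0.
have UT : U <= T by rewrite ler_nat ffact_le_expn.
have cardU : #|[set t : d.-tuple G | uniq t]%SET| = (N ^_ d)%N.
  rewrite /N -card_uniq_tuples; apply: eq_card => t.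
  by rewrite !inE (_ : all _ _)//; apply/allP.
have -> : #|[set S : {set G} | #|S| == d]%SET|%:R^-1 *
       \sum_(S in [set S : {set G} | #|S| == d]%SET) psi (enum S) = U^-1 * A.
  rewrite /A (eq_bigr (fun t : d.-tuple G => psi (enum [set x in t]%SET))); last first.
    move=> t ut; apply: psiP; apply: uniq_perm => //; first exact: enum_uniq.
    by move=> x; rewrite mem_enum inE.
  rewrite (sum_uniq_tuples d (fun S => psi (enum S))) /U -bin_ffact natrM.
  rewrite -[X in _ = _ * X]mulr_natr invfM [RHS]mulrACA.
  rewrite mulVf ?pnatr_eq0 -?lt0n ?fact_gt0// mulr1 card_draws.
  by congr (_ * _); apply: eq_bigl => S; rewrite inE.
have -> : \sum_(t : d.-tuple G) psi t = A + B.
  by rewrite (bigID (fun t : d.-tuple G => uniq t)).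
have AM : `|A| <= U * M.
  apply: (le_trans (ler_norm_sum _ _ _)).
  apply: (@le_trans _ _ (\sum_(t : d.-tuple G | uniq t) M)).
    by apply: ler_sum => t _; exact: psiM.
  rewrite sumr_const -mulr_natl /U -cardU.
  by rewrite le_eqVlt cardsE eqxx.
have BM : `|B| <= (T - U) * M.
  apply: (le_trans (ler_norm_sum _ _ _)).
  apply: (@le_trans _ _ (\sum_(t : d.-tuple G | ~~ uniq t) M)).
    by apply: ler_sum => t _; exact: psiM.
  rewrite sumr_const -mulr_natl le_eqVlt; apply/orP; left; apply/eqP.
  congr (_ * _); apply/eqP; rewrite -subr_eq opprK /U /T /N -natrD -card_tuple -cardU.
  apply/eqP; congr (_%:R); rewrite -(cardC (fun t : d.-tuple G => uniq t)).
  by rewrite addnC cardsE.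
apply: (@le_trans _ _ (2 * M * (1 - U / T))); last first.
  rewrite ler_wpM2l ?mulr_ge0// lerBlDr -lerBlDl.
  exact: ffact_ratio_ge.
(* with [U] of the [T] tuples repetition-free, the difference splits in two parts,
   each of size at most [M (1 - U / T)] *)
have -> : U^-1 * A - T^-1 * (A + B) = (1 - U / T) * (A / U) - T^-1 * B.
  by field; rewrite !gt_eqF.
apply: (le_trans (ler_normB _ _)); rewrite !normrM.
have UT1 : 0 <= 1 - U / T by rewrite subr_ge0 ler_pdivrMr ?mul1r.
rewrite (ger0_norm UT1) !normfV (gtr0_norm T0) (gtr0_norm U0).
have -> : 2 * M * (1 - U / T) = (1 - U / T) * M + T^-1 * ((T - U) * M).
  by field; rewrite !gt_eqF.
apply: lerD; apply: ler_wpM2l => //; last by rewrite invr_ge0 ltW.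
by rewrite ler_pdivrMr// mulrC.
Qed.

End sampling.

(** * Integrals of bounded functions *)

Section bounded.
Context d (T : measurableType d) (R : realType).
Implicit Types (f g : T -> R) (P : probability T R).

Lemma bounded_funP (U : Type) (f : U -> R) : bounded_fun f <->
  exists M, forall x, `|f x| <= M.
Proof.
split=> [[M [_ h]]|[M h]].
  by exists (M + 1) => x; apply: h => //; rewrite ltrDl.
exists M; split; first exact: num_real.
by move=> N MN x _; apply: le_trans (h x) (ltW MN).
Qed.

Lemma bounded_integrable P f M : measurable_fun setT f ->
  (forall x, `|f x| <= M) -> P.-integrable setT (EFin \o f).
Proof.
move=> mf fM; apply: measurable_bounded_integrable => //.
- by rewrite (le_lt_trans (probability_le1 _ _))// ltry.
- by apply/bounded_funP; exists M.
Qed.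

Lemma integral_EFin P f M : measurable_fun setT f ->
  (forall x, `|f x| <= M) ->
  (\int[P]_x (f x)%:E)%E = (\int[P]_x f x)%:E.
Proof.
move=> mf fM; rewrite /Rintegral fineK//.
exact: integrable_fin_num (bounded_integrable P mf fM).
Qed.

Lemma le_norm_Rintegral P f M : measurable_fun setT f ->
  (forall x, `|f x| <= M) -> `|\int[P]_x f x| <= M.
Proof.
move=> mf fM; have fi := bounded_integrable P mf fM.
apply: le_trans (le_normr_Rintegral _ fi) _ => //.
have -> : M = \int[P]_x cst M x.
  by rewrite Rintegral_cst// [X in fine X](probability_setT P) mulr1.
apply: le_Rintegral => //; first exact: integrable_norm.
apply: (@bounded_integrable _ _ `|M|) => //.
Qed.

Lemma Rintegral_prob_cst P (c : R) : \int[P]_x (fun=> c) x = c.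
Proof. by rewrite Rintegral_cst// [X in fine X](probability_setT P) mulr1. Qed.

Lemma integral_empirical (s : seq T) f : measurable_fun setT f ->
  (\int[empirical R s]_x (f x)%:E)%E =
  ((size s)%:R^-1 * \sum_(x <- s) f x)%:E.
Proof.
have ge0E g : measurable_fun setT g -> (forall x, 0 <= g x) ->
  (\int[empirical R s]_x (g x)%:E)%E =
    ((size s)%:R^-1 * \sum_(x <- s) g x)%:E.
  move=> mg g0; have mg' : measurable_fun setT (EFin \o g).
    exact/measurable_EFinP.
  rewrite ge0_integral_mscale//=; last by move=> x _; rewrite lee_fin.
  rewrite ge0_integral_measure_sum//; last by move=> x _; rewrite lee_fin.
  rewrite (eq_bigr (fun k : 'I__ => (g (nth point s k))%:E)); last first.
    move=> k _. by rewrite /= integral_dirac// diracT mul1e.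
  rewrite sumEFin -EFinM; congr (_ * _)%:E.
  by rewrite (big_nth point) big_mkord.
move=> mf; rewrite integralE funerpos funerneg.
rewrite ge0E; [|exact: measurable_funrpos|by move=> x; exact: funrpos_ge0].
rewrite ge0E; [|exact: measurable_funrneg|by move=> x; exact: funrneg_ge0].
rewrite -EFinB -mulrBr -sumrB; congr (_ * _)%:E; apply: eq_bigr => x _.
by rewrite -[in RHS](funrposBneg f).
Qed.

(** The variable takes finitely many values, each on a measurable event, so a
    composite with it is a simple function.  Integrating the constant 1 gives the
    common probability of the values. *)
Lemma integral_uniform_on P (I : finType) (U : choiceType) (A : {set I})
    (phi : I -> U) (X : T -> U) (h : U -> R) :
  injective phi -> uniform_on P X [set phi i | i in [set` A]] ->
  measurable_fun setT (h \o X) /\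
  (\int[P]_w (h (X w))%:E)%E =
  (#|A|%:R^-1 * \sum_(i in A) h (phi i))%:E.
Proof.
move=> phiI [XA Xm]; set B := image _ _ in XA Xm.
pose F i := X @^-1` [set phi i].
have mF i : measurable (F i).
  have [iA|iA] := boolP (i \in A); first by have [] := Xm _ (imageP phi iA).
  suff -> : F i = set0 by [].
  rewrite -subset0 => w /= Xw; have [j jA] := XA w.
  by rewrite Xw => /phiI ji; move: iA; rewrite -ji (jA : j \in A).
have tF : trivIset [set` (index_enum I)] F.
  move=> i j _ _ [w []]; rewrite /F /= => -> /phiI //.
have FT : \big[setU/set0]_(i <- index_enum I) F i = setT.
  rewrite -subTset => w _; have [i iA Xw] := XA w.
  by rewrite -bigcup_seq; exists i => //=; rewrite mem_index_enum.
have mh (g : U -> R) : measurable_fun setT (g \o X).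
  move=> _ Y mY; rewrite setTI.
  have -> : (g \o X) @^-1` Y =
      \big[setU/set0]_(i <- index_enum I | `[<Y (g (phi i))>]) F i.
    apply/seteqP; split => [w /= Yw|w].
      have [i iA Xw] := XA w; rewrite -bigcup_seq_cond.
      by exists i; rewrite /= ?mem_index_enum//=; apply/asboolP; rewrite Xw.
    rewrite -bigcup_seq_cond => -[i /= /andP[_ /asboolP Yi]].
    by rewrite /F /= => ->.
  by apply: bigsetU_measurable => i _; exact: mF.
pose p := (#|` fset_set B|%fset%:R)^-1 : R.
have E (g : U -> R) : (\int[P]_w (g (X w))%:E)%E =
    (\sum_(i in A) g (phi i) * p)%:E.
  rewrite -FT integral_bigsetU_EFin//; last 2 first.
  - exact: index_enum_uniq.
  - by rewrite FT; apply/measurable_EFinP; exact: mh.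
  rewrite -sumEFin [RHS]big_mkcond /=; apply: eq_bigr => i _.
  rewrite (eq_integral (fun=> (g (phi i))%:E)); last first.
    by move=> w; rewrite inE /F /= => ->.
  rewrite integral_cst// ; have [iA|iA] := boolP (i \in A).
    by have [_ e] := Xm _ (imageP phi iA); rewrite EFinM; congr (_ * _)%E.
  suff -> : F i = set0 by rewrite measure0 mule0.
  rewrite -subset0 => w /= Xw; have [j jA] := XA w.
  by rewrite Xw => /phiI ji; move: iA; rewrite -ji (jA : j \in A).
split; first exact: mh.
rewrite E -mulr_suml mulrC; congr (_ * _)%:E.
have := E (fun=> 1); rewrite -mulr_suml sumr_const.
rewrite integral_cst// [X in (_ * X)%E](probability_setT P) mule1 => -[/esym pA].
have A0 : #|A|%:R != 0 :> R.
  by apply: contra_eq_neq pA => ->; rewrite mul0r eq_sym oner_neq0.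
by apply: (mulfI A0); rewrite pA mulfV.
Qed.
End bounded.

(** * Convolution powers as iterated averages *)

Section convolution_powers.
Variable R : realType.
Local Notation C := R[i].
Implicit Types (P Q : probability (borel C) R) (g : C -> R).

Definition shift_avg P g (z : C) : R := \int[P]_w g ((w : C) + z).

Lemma measurable_shift g z : measurable_fun [set: borel C] (g : borel C -> R) ->
  measurable_fun [set: borel C] (fun w : borel C => g ((w : C) + z)).
Proof.
move=> mg; have -> : (fun w : borel C => g ((w : C) + z)) =
  (g : borel C -> R) \o @Defs.cadd R \o (fun w : borel C => (w, z : borel C)) by [].
apply: measurableT_comp; last exact: pair2_measurable.
exact: measurableT_comp.
Qed.

Lemma shift_avg_bounded P g M :
  measurable_fun [set: borel C] (g : borel C -> R) ->
  (forall z, `|g z| <= M) -> forall z, `|shift_avg P g z| <= M.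
Proof.
move=> mg gM z.
by apply: (@le_norm_Rintegral _ _ _ P (fun w : borel C => g ((w : C) + z))) => //;
  exact: measurable_shift.
Qed.

(** Fubini's theorem for [g (x + y)], with [x] integrated first. *)
Lemma shift_avg_Fubini P Q g M :
  measurable_fun [set: borel C] (g : borel C -> R) ->
  (forall z, `|g z| <= M) ->
  measurable_fun [set: borel C] (shift_avg P g : borel C -> R) /\
  (\int[convolution P Q]_z (g z)%:E)%E = (\int[Q]_z (shift_avg P g z)%:E)%E.
Proof.
move=> mg gM.
have mgc : measurable_fun setT (g \o @Defs.cadd R) by exact: measurableT_comp.
have gi : (P \x Q)%E.-integrable setT (EFin \o (g \o @Defs.cadd R)).
  by apply: (@bounded_integrable _ _ _ (P \x Q)%E _ M mgc) => z; exact: gM.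
have GE : (fun y => (shift_avg P g y)%:E) =
    fubini_G P (EFin \o (g \o @Defs.cadd R)).
  apply/funext => y; rewrite /fubini_G /= -(@integral_EFin _ _ _ _ _ M)//.
  exact: measurable_shift.
split.
  by apply/measurable_EFinP; have := measurable_fubini_G gi; rewrite -GE.
rewrite integral_distribution//; last exact/measurable_EFinP.
rewrite -[LHS](integral21_prod_meas1 gi).
by apply: eq_integral => y _; rewrite -GE.
Qed.

(** Each convolution factor contributes one application of the averaging
    operator. *)
Lemma integral_conv_pow P g M d :
  measurable_fun [set: borel C] (g : borel C -> R) ->
  (forall z, `|g z| <= M) ->
  (\int[conv_pow P d]_z (g z)%:E)%E = (iter d (shift_avg P) g 0)%:E.
Proof.
elim: d g => [|d ih] g mg gM.
  by rewrite /conv_pow/= integral_dirac ?diracT ?mul1e//; exact/measurable_EFinP.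
have [mT ->] := shift_avg_Fubini P (conv_pow P d) mg gM.
by rewrite ih ?iterSr//; exact: shift_avg_bounded.
Qed.

End convolution_powers.

(** * From roots of unity to the circle *)

Section equidistribution.
Variable R : realType.
Local Notation C := R[i].
Local Notation U := (uniform_prob (@ltr01 R)).

Lemma uniform_prob_itv (a b : R) : 0 <= a -> a <= b -> b <= 1 ->
  U `[a, b[%classic = (b - a)%:E.
Proof.
move=> a0 ab b1; rewrite /uniform_prob integral_uniform_pdf setIidl; last first.
  move=> t; rewrite /= !in_itv/= => /andP[at_ tb].
  by rewrite (le_trans a0 at_) (le_trans (ltW tb) b1).
rewrite (eq_integral (fun=> 1%E)); last first.
  move=> t; rewrite inE/= in_itv/= => /andP[at_ tb].
  by rewrite /uniform_pdf (le_trans a0 at_) (le_trans (ltW tb) b1)/= subr0 invr1.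
rewrite integral_cst// mul1e [LHS]lebesgue_measure_itv/= lte_fin.
by rewrite lt_neqAle ab andbT; case: eqVneq => [->|_] //=; rewrite subrr.
Qed.

(** On [0, 1) this is the integer part of [t (n+1)]; elsewhere the default values
    of [truncn] and [inord] make it 0. *)
Definition cell (n : nat) (t : R) : 'I_n.+1 := inord (Num.truncn (t * n.+1%:R)).

Lemma preimage_cell n (k : 'I_n.+1) : k != ord0 ->
  cell n @^-1` [set k] = `[k%:R / n.+1%:R, k.+1%:R / n.+1%:R[%classic.
Proof.
move=> k0; have n0 : 0 < n.+1%:R :> R by rewrite ltr0n.
apply/seteqP; split => t /=; rewrite in_itv/= ler_pdivrMr// ltr_pdivlMr//.
  rewrite /cell => tk.
  have tn : (Num.truncn (t * n.+1%:R) < n.+1)%N.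
    rewrite ltnNge; apply: contra k0 => h; rewrite -tk; apply/eqP/val_inj.
    by rewrite /= /inord val_insubd ltnNge h.
  have tkE : Num.truncn (t * n.+1%:R) = k by rewrite -tk inordK.
  have t0 : 0 <= t * n.+1%:R.
    rewrite leNgt; apply: contra k0 => h; apply/eqP/val_inj; rewrite /= -tkE.
    by apply/eqP; rewrite -leqn0 truncn_le_nat (lt_trans h).
  by rewrite -tkE; exact: truncn_itv.
move=> h; rewrite /cell; apply: val_inj; rewrite /= inordK (truncn_def h)//.
Qed.

(** The cell 0 is handled as the complement of [1/(n+1), 1), which absorbs the
    default values outside [0, 1). *)
Lemma uniform_on_cell n : uniform_on U (cell n) [set id i | i in [set` [set: 'I_n.+1]%SET]].
Proof.
have n0 : 0 < n.+1%:R :> R by rewrite ltr0n.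
split=> [w|k _]; first by exists (cell n w) => //=; rewrite inE.
have -> : (#|` fset_set [set id i | i in [set` [set: 'I_n.+1]%SET]]|)%fset = n.+1.
  rewrite image_id (_ : [set` _] = [set` [fset x in 'I_n.+1]%fset]).
    by rewrite set_fsetK card_imfset//= -cardE card_ord.
  by apply/seteqP; split => x //= _; rewrite !inE.
have i0 : (0 : R) <= n.+1%:R^-1 by rewrite invr_ge0 ltW.
have i1 : n.+1%:R^-1 <= 1 :> R by rewrite invf_le1// ler1n.
have [->|k0] := eqVneq k ord0; last first.
  rewrite preimage_cell//; split; first exact: measurable_itv.
  apply: etrans (uniform_prob_itv _ _ _) _; rewrite ?divr_ge0//.
  - by rewrite ler_pM2r ?invr_gt0// ler_nat.
  - by rewrite ler_pdivrMr// mul1r ler_nat ltn_ord.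
  - by rewrite -mulrBl -natr1 addrC addKr mul1r.
have -> : cell n @^-1` [set ord0] = ~` `[n.+1%:R^-1, 1[%classic.
  apply/seteqP; split => t /=; rewrite in_itv/=.
    rewrite /cell => t0 /andP[t1 t2].
    have h1 : (0 < Num.truncn (t * n.+1%:R))%N.
      by rewrite truncn_gt0 -ler_pdivrMr// mul1r.
    have h2 : (Num.truncn (t * n.+1%:R) < n.+1)%N.
      rewrite truncn_lt_nat ?mulr_ge0 ?(le_trans _ t1)//.
      by rewrite gtr_pMl.
    by move: h1; rewrite -(inordK h2) t0.
  move=> /negP; rewrite negb_and -!ltNge -leNgt => /orP[t1|t1].
    rewrite /cell (_ : Num.truncn _ = 0)%N; first by apply: val_inj; rewrite /= inordK.
    apply/eqP; rewrite -leqn0 truncn_le_nat.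
    by rewrite -ltr_pdivlMr// mul1r.
  apply/val_inj; rewrite /= /inord val_insubd ifF//.
  apply/negbTE; rewrite -leqNgt -[X in (X <= _)%N](@natrK R); apply: le_truncn.
  by rewrite ler_peMl// ltW.
split; first exact: measurableC.
rewrite probability_setC//.
rewrite [X in (1 - X)%E](_ : _ = (1 - n.+1%:R^-1)%:E); last exact: uniform_prob_itv.
by rewrite -EFinB opprB addrC subrK.
Qed.

(** The roots are indexed from 1 to [m] in [roots_law] and from 0 to [m - 1]
    here; both ends stand for the root 1. *)
Lemma shift_avg_roots (m : posnat) (g : C -> R) z :
  measurable_fun [set: borel C] (g : borel C -> R) ->
  shift_avg (Defs.eta R (Some m)) g z =
  (sval m)%:R^-1 * \sum_(k < sval m) g (omega R (sval m) ^+ k + z).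
Proof.
move=> mg; have mgz := measurable_shift z mg.
rewrite /shift_avg /Rintegral [X in fine X](integral_empirical _ mgz) /=.
rewrite size_map size_iota; congr (_ * _); rewrite big_map.
case: m => -[//|m] m0 /=.
under eq_bigr do rewrite omegaX.
rewrite -[LHS]/(\sum_(1 <= k < m.+2) g (omega R m.+1 ^+ k + z)).
rewrite big_nat_recr//= -(big_mkord xpredT (fun k => g (omega R m.+1 ^+ k + z))).
rewrite [RHS]big_ltn// addrC; congr (g (_ + z) + _).
by rewrite (prim_expr_order (omega_prim R m0)).
Qed.

(** Couples the roots of unity of every order to one uniform variable [t], as
    needed for a pointwise limit under the integral. *)
Lemma shift_avg_cell n (g : C -> R) z :
  measurable_fun [set: borel C] (g : borel C -> R) ->
  measurable_fun setT (fun t => g (omega R n.+1 ^+ cell n t + z)) /\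
  shift_avg (Defs.eta R (Some (exist _ n.+1 isT : posnat))) g z =
  \int[U]_t g (omega R n.+1 ^+ cell n t + z).
Proof.
move=> mg; rewrite shift_avg_roots//=.
have [ms es] := @integral_uniform_on _ _ _ U 'I_n.+1 _ [set: 'I_n.+1]%SET id (cell n)
  (fun k => g (omega R n.+1 ^+ k + z)) (fun _ _ e => e) (uniform_on_cell n).
split => //.
rewrite /Rintegral [X in fine X]es /= cardsT card_ord; congr (_ * _).
by apply: eq_bigl => k; rewrite inE.
Qed.

Lemma shift_avg_circle (g : C -> R) z :
  measurable_fun [set: borel C] (g : borel C -> R) ->
  (exists M, forall z, `|g z| <= M) ->
  measurable_fun setT (fun t => g (expi (2 * pi * t) + z)) /\
  shift_avg (Defs.eta R None) g z = \int[U]_t g (expi (2 * pi * t) + z).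
Proof.
move=> mg [M gM]; have mgz := measurable_shift z mg.
have mgt : measurable_fun setT (fun t => g (expi (2 * pi * t) + z)).
  rewrite (_ : (fun _ => _) = (fun w : borel C => g ((w : C) + z)) \o @circle_param R)//.
  exact: (measurableT_comp mgz (@measurable_circle_param R)).
split => //; rewrite /shift_avg /Rintegral; congr fine.
rewrite [LHS]integral_distribution//; first exact/measurable_EFinP.
exact: (@bounded_integrable _ _ _ U _ M mgt).
Qed.

Lemma cvg_cell t : 0 <= t -> t < 1 ->
  (cell n t)%:R / n.+1%:R @[n --> \oo] --> t.
Proof.
move=> t0 t1; apply/cvgrPdist_le => e e0.
have := @cvg_harmonic R => /cvgrPdist_le /(_ e e0); apply: filterS => n.
rewrite /harmonic sub0r normrN; apply: le_trans.
have n0 : 0 < n.+1%:R :> R by rewrite ltr0n.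
rewrite [X in _ <= X]gtr0_norm ?invr_gt0//.
have tn : 0 <= t * n.+1%:R by rewrite mulr_ge0// ltW.
rewrite /cell inordK; last by rewrite truncn_lt_nat// gtr_pMl.
have /andP[h1 h2] := truncn_itv tn.
rewrite ger0_norm ?subr_ge0 ?ler_pdivrMr// lerBlDr.
rewrite -[X in X + _]mul1r -mulrDl ler_pdivlMr// nat1r.
exact: ltW.
Qed.

(** Neighbourhoods in the modulus topology contain boxes. *)
Lemma continuous_complex (T : topologicalType) (f : T -> C) :
  continuous (fun x => complex.Re (f x)) ->
  continuous (fun x => complex.Im (f x)) -> continuous f.
Proof.
move=> cRe cIm x A; rewrite nbhsE => -[V [oV Vfx] VA].
have [e e0 eV] := open_complexE oV Vfx.
have /cvgrPdist_lt/(_ e e0) nRe := cRe x.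
have /cvgrPdist_lt/(_ e e0) nIm := cIm x.
apply: filterS2 nRe nIm => t tRe tIm; apply: VA.
by apply: eV; rewrite distrC.
Qed.

Lemma continuous_expi : continuous (@expi R : R -> C).
Proof.
by apply: continuous_complex; [exact: continuous_cos|exact: continuous_sin].
Qed.

Lemma iter_shift_avg_bounded (P : probability (borel C) R) (g : C -> R) M d :
  measurable_fun [set: borel C] (g : borel C -> R) -> (forall z, `|g z| <= M) ->
  measurable_fun [set: borel C] (iter d (shift_avg P) g : borel C -> R) /\
  (forall z, `|iter d (shift_avg P) g z| <= M).
Proof.
move=> mg gM; elim: d => // d [mi iM] /=; split.
  exact: (shift_avg_Fubini P P mi iM).1.
exact: shift_avg_bounded.
Qed.

(** The base point is allowed to move with [n]: after peeling off one averaging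
    step the remaining iterate is evaluated at the moving point
    [omega ^ cell + z_ n], so a statement at a fixed base point would not be
    inductive.  Each step is dominated convergence over the coupling of
    [shift_avg_cell]. *)
Lemma iter_shift_avg_cvg (g : C -> R) M d (z_ : nat -> C) (z : C) :
  continuous g -> (forall z, `|g z| <= M) ->
  z_ n @[n --> \oo] --> z ->
  iter d (shift_avg (Defs.eta R (Some (exist _ n.+1 isT : posnat)))) g (z_ n)
    @[n --> \oo] --> iter d (shift_avg (Defs.eta R None)) g z.
Proof.
move=> cg gM; have mg := continuous_borel_measurable cg.
elim: d z_ z => [|d ih] z_ z z_z.
  exact: (cvg_comp _ _ z_z (cg z)).
pose h_ n := iter d (shift_avg (Defs.eta R (Some (exist _ n.+1 isT : posnat)))) g.
pose h := iter d (shift_avg (Defs.eta R None)) g.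
have hP_ n := iter_shift_avg_bounded (Defs.eta R (Some (exist _ n.+1 isT : posnat))) d mg gM.
have [mh hM] := iter_shift_avg_bounded (Defs.eta R None) d mg gM.
have [mf fE] := shift_avg_circle z mh (ex_intro _ M hM).
pose f_ n t := h_ n (omega R n.+1 ^+ cell n t + z_ n).
have f_E n := shift_avg_cell n (z_ n) (hP_ n).1.
rewrite /= fE.
rewrite (_ : (fun n => _) = fun n => \int[U]_t f_ n t); last first.
  by apply/funext => n; rewrite -(f_E n).2.
have mf_ n : measurable_fun setT (fun t => (f_ n t)%:E).
  by apply/measurable_EFinP; exact: (f_E n).1.
have mf' : measurable_fun setT (fun t => (h (expi (2 * pi * t) + z))%:E).
  exact/measurable_EFinP.
have [] := @dominated_convergence _ _ _ U setT measurableT _ _ (fun=> M%:E) mf_ mf'.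
(* pointwise convergence holds on [0, 1), which has full measure *)
- exists (~` `[0, 1[%classic); split; first exact: measurableC.
    apply: etrans (@probability_setC _ _ _ U _ _) _ => //.
    rewrite [X in (1 - X)%E](_ : _ = (1 - 0)%:E); last exact: uniform_prob_itv.
    by rewrite subr0 subee.
  apply: subsetC => t; rewrite /= in_itv/= => /andP[t0 t1] _.
  apply/fine_cvgP; split; first by apply: nearW.
  apply: (ih (fun n => omega R n.+1 ^+ cell n t + z_ n)).
  apply: cvgD; last exact: z_z.
  rewrite (_ : (fun n => _) = fun n => expi (2 * pi * ((cell n t)%:R / n.+1%:R))).
    apply: (cvg_comp (fun n => 2 * pi * ((cell n t)%:R / n.+1%:R)) (@expi R)); last first.
      exact: continuous_expi.
    by apply: cvgMr; exact: cvg_cell.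
  by apply/funext => n; rewrite mulrA omegaX.
- by apply: (@bounded_integrable _ _ _ U (fun=> M) `|M|).
- by apply: aeW => t n _; rewrite lee_fin; apply: (hP_ n).2.
move=> _ _; rewrite (@integral_EFin _ _ _ U _ M mf) => [/fine_cvgP[_]//|t].
exact: hM.
Qed.

End equidistribution.

(** * Moments of sums of roots of unity *)

Section moments.
Variable R : realType.
Local Notation C := R[i].
Variable m : nat.
Hypothesis m0 : (0 < m)%N.
Let zp := omega_prim R m0.

Definition root_avg (g : C -> C) (z : C) : C :=
  m%:R^-1 * \sum_(k < m) g (omega R m ^+ k + z).

Let root_avgE g z :
  root_avg g z = m%:R^-1 * \sum_(k < m) g (omega R m ^+ k + z).
Proof. by []. Qed.

Let mC0 : m%:R != 0 :> C. Proof. by rewrite pnatr_eq0 -lt0n. Qed.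

Lemma root_power_sum i :
  m%:R^-1 * \sum_(k < m) (omega R m ^+ k) ^+ i = (m %| i)%:R :> C.
Proof.
under eq_bigr do rewrite -exprM mulnC exprM.
have [mi|mi] := boolP (m %| i)%N.
  have -> : omega R m ^+ i = 1 by apply/eqP; rewrite -(prim_order_dvd zp).
  under eq_bigr do rewrite expr1n.
  by rewrite sumr_const card_ord mulVf.
have := subrX1 (omega R m ^+ i) m.
rewrite -exprM mulnC exprM (prim_expr_order zp) expr1n subrr.
move=> /esym/eqP; rewrite mulf_eq0 => /orP[|/eqP->]; last by rewrite mulr0.
by rewrite subr_eq0 -(prim_order_dvd zp) (negbTE mi).
Qed.

Lemma iter_root_avg_sum d n (c : 'I_n -> C) (g : 'I_n -> C -> C) z :
  iter d root_avg (fun w => \sum_i c i * g i w) z =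
  \sum_i c i * iter d root_avg (g i) z.
Proof.
elim: d z => //= d ih z; rewrite root_avgE.
rewrite (eq_bigr _ (fun (k : 'I_m) _ => ih (omega R m ^+ k + z))).
rewrite exchange_big mulr_sumr; apply: eq_bigr => i _.
by rewrite -mulr_sumr mulrCA.
Qed.

Definition moment d j : C := iter d root_avg (fun w => w ^+ j) 0.

(** The binomial formula for the sum of one root of unity and the others; the
    [i]-th power sum over the roots selects the [i] divisible by [m]. *)
Lemma momentS d j : moment d.+1 j =
  \sum_(i < j.+1) ((m %| i)%:R *+ 'C(j, i)) * moment d (j - i).
Proof.
rewrite /moment iterSr -iter_root_avg_sum; congr (iter d root_avg _ 0).
apply/funext => z; rewrite /root_avg.
under eq_bigr do rewrite addrC exprDn.
rewrite exchange_big mulr_sumr; apply: eq_bigr => i _.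
rewrite -root_power_sum mulrnAl -mulrA mulr_suml -mulrnAr -sumrMnl.
by congr (_ * _); apply: eq_bigr => k _; rewrite mulrC.
Qed.

Lemma moment0 d : moment d 0 = 1.
Proof.
elim: d => // d ih; rewrite momentS big_ord_recl big_ord0 addr0 /=.
by rewrite dvdn0 bin0 ih mulr1.
Qed.

Lemma moment_ndvd d j : ~~ (m %| j)%N -> moment d j = 0.
Proof.
elim: d j => [|d ih] j mj.
  by rewrite /moment /= expr0n; case: j mj => //; rewrite dvdn0.
rewrite momentS big1 // => i _; have [mi|mi] := boolP (m %| i)%N; last first.
  by rewrite mul0rn mul0r.
rewrite ih ?mulr0//; apply: contra mj => mji.
by rewrite -(subnK (ltnSE (ltn_ord i))) dvdn_add.
Qed.

(** In the recursion for [j = m] only [i = 0] and [i = m] contribute, so each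
    additional summand adds 1. *)
Lemma moment_order d : moment d m = d%:R.
Proof.
elim: d => [|d ih]; first by rewrite /moment/= expr0n gtn_eqF.
rewrite momentS big_ord_recr /= dvdnn binn subnn moment0 mulr1.
rewrite (bigD1 (Ordinal m0))//= dvdn0 bin0 mul1r subn0 ih big1 ?addr0 ?natr1//.
move=> i i0; rewrite gtnNdvd ?mul0rn ?mul0r// lt0n.
by apply: contra i0 => /eqP i0; apply/eqP/val_inj.
Qed.

(** An average over unit vectors enlarges the radius by 1, so [d] averages
    starting in the disc of radius [r] only see the values of [g] on the disc of
    radius [r + d]. *)
Lemma iter_shift_avg_Re (mm : posnat) d (r : nat) (g : C -> R) (f : C -> C) : sval mm = m ->
  continuous g ->
  (exists M, forall z, `|g z| <= M) ->
  (forall z : C, `|z| <= (r + d)%:R -> g z = complex.Re (f z)) ->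
  forall z : C, `|z| <= r%:R ->
  iter d (shift_avg (Defs.eta R (Some mm))) g z = complex.Re (iter d root_avg f z).
Proof.
move=> mmE cg [M gM]; have mg := continuous_borel_measurable cg.
elim: d r => [|d ih] r gf z zr; first by apply: gf; rewrite addn0.
rewrite /= shift_avg_roots; last exact: (iter_shift_avg_bounded _ _ mg gM).1.
rewrite mmE root_avgE.
have ReM (a : R) (w : C) : complex.Re (a%:C%C * w) = a * complex.Re w.
  by case: w => x y; simpc.
rewrite -[_^-1 in RHS](_ : (m%:R^-1)%:C%C = _); last first.
  by rewrite fmorphV rmorph_nat.
have ReD : {morph (@complex.Re R : C -> R) : x y / x + y >-> x + y} by move=> [? ?] [? ?].
rewrite ReM (big_morph (@complex.Re R : C -> R) ReD (erefl _)).
congr (_ * _); apply: eq_bigr => k _.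
apply: (ih r.+1) => [w|].
  by rewrite addSnnS; exact: gf.
rewrite (le_trans (ler_normD _ _))// normrX normr_expi expr1n.
by rewrite -nat1r lerD2l.
Qed.

End moments.

(** * The compactified integers *)

Section Nstar.
Variable R : realType.

(** The integer [k + 1], so that the masses at finite points form a sequence
    indexed from 0. *)
Definition fin_point (k : nat) : Nstar := Some (exist _ k.+1 isT : posnat).

Lemma fin_pointE (m : posnat) : Some m = fin_point (sval m).-1 :> Nstar.
Proof. by case: m => -[|m] mP //; congr Some; apply: val_inj. Qed.

Lemma fin_point_inj : injective fin_point.
Proof. by move=> i j [->]. Qed.

Definition enumN (k : nat) : Nstar := if k is k'.+1 then fin_point k' else None.

Lemma enumN_inj : injective enumN.
Proof. by move=> [|i] [|j] //= /fin_point_inj ->. Qed.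

Lemma enumN_surj x : exists k, enumN k = x.
Proof. by case: x => [m|]; [rewrite fin_pointE; eexists _.+1|exists 0%N]. Qed.

Lemma measurable_Nstar (A : set (borel Nstar)) : measurable A.
Proof.
have -> : A = \bigcup_k (if `[<A (enumN k)>] then [set enumN k] else set0).
  apply/seteqP; split => [x Ax|x [k _]]; last by case: asboolP => // Ak ->.
  have [k kx] := enumN_surj x; exists k => //; case: asboolP; rewrite kx//.
apply: bigcupT_measurable => k; case: asboolP => // _.
exact: measurable_Nstar1.
Qed.

Lemma measurable_fun_Nstar d (T : measurableType d) (h : borel Nstar -> T) :
  measurable_fun setT h.
Proof. by move=> _ B mB; exact: measurable_Nstar. Qed.

(** Compact subsets of a discrete space are finite, hence bounded here. *)
Lemma nbhs_infty (A : set Nstar) : nbhs (None : Nstar) A <->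
  A None /\ exists K, forall k, (K <= k)%N -> A (fin_point k).
Proof.
split=> [[W [cW _] WA]|[A0 [K AK]]].
  split; first by apply: WA; right.
  have /compact_near_coveringP/(_ nat \oo (fun K m => (sval m < K.+1)%N)) := cW.
  case=> [x Wx|K _ KW].
    exists ([set x], [set K | (sval x < K.+1)%N]) => /=.
      split; first exact: discrete_set1.
      by exists (sval x).
    by move=> [y K] /= [-> ].
  exists K => k Kk; apply: WA; left; exists (exist _ k.+1 isT : posnat) => //.
  move=> /(KW K (leqnn K)) /=; rewrite ltnS => h.
  by have := leq_trans h Kk; rewrite ltnn.
exists [set m : discrete_topology posnat | (sval m <= K)%N].
  split; last exact: discrete_closed.
  apply: finite_compact.
  apply: (@sub_finite_set _ _ ((fun k => (exist _ k.+1 isT : posnat)) @` `I_K)).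
    move=> [[//|m] mP] /= mK; exists m => //; exact: val_inj.
  exact/finite_image/finite_II.
move=> x [[m /= mK <-]|->//].
rewrite fin_pointE; apply: AK; rewrite -ltnS prednK ?(valP m)//.
by rewrite ltnNge; apply/negP.
Qed.

Lemma continuous_Nstar (h : Nstar -> R) :
  h (fin_point k) @[k --> \oo] --> h None -> continuous h.
Proof.
move=> hoo [m|] A hA.
  have mm := @one_point_compactification_some_nbhs (discrete_topology posnat) m
    [set m] (discrete_set1 m).
  change (nbhs (Some m : Nstar) (h @^-1` A)).
  refine (@filterS Nstar (nbhs (Some m : Nstar)) _ _ _ _ mm) => _ [_ /= -> <-]; exact: nbhs_singleton hA.
apply/nbhs_infty; split; first exact: nbhs_singleton hA.
have [K _ KA] := hoo A hA; exists K => k Kk; exact: KA.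
Qed.

(** Only the finite points are recorded; the mass at infinity is the rest. *)
Definition mass (rho : probability (borel Nstar) R) k : R :=
  fine (rho [set fin_point k]).

Lemma Rintegral_step (rho : probability (borel Nstar) R) c (a : nat -> R) K :
  \int[rho]_x (c + \sum_(k < K) a k * \1_([set fin_point k] : set (borel Nstar)) x) =
  c + \sum_(k < K) a k * mass rho k.
Proof.
pose s n (x : borel Nstar) : R :=
  \sum_(k < n) a k * \1_([set fin_point k] : set (borel Nstar)) x.
have sB n x : `|s n x| <= \sum_(k < n) `|a k|.
  apply: (le_trans (ler_norm_sum _ _ _)); apply: ler_sum => k _.
  rewrite normrM ler_piMr// indicE; case: (_ \in _); first by rewrite normr1.
  by rewrite normr0.
have si n : rho.-integrable setT (EFin \o s n).
  exact: bounded_integrable (measurable_fun_Nstar _) (sB n).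
have ii k : rho.-integrable setT (EFin \o (\1_([set fin_point k] : set (borel Nstar)) : borel Nstar -> R)).
  apply: (@bounded_integrable _ _ _ rho _ 1) => [|x]; first exact: measurable_fun_Nstar.
  by rewrite indicE; case: (_ \in _); rewrite ?normr1 ?normr0.
rewrite RintegralD//; last 2 first.
  by apply: (@bounded_integrable _ _ _ rho (fun=> c) `|c|).
  exact: si.
rewrite Rintegral_prob_cst; congr (c + _).
elim: K => [|n ih].
  rewrite big_ord0 -[RHS](Rintegral_prob_cst rho 0); apply: eq_Rintegral => x _.
  by rewrite big_ord0.
under eq_Rintegral do rewrite big_ord_recr/=.
rewrite RintegralD//; last 2 first.
- exact: si.
- apply: (@bounded_integrable _ _ _ rho _ `|a n|) => [|x]; first exact: measurable_fun_Nstar.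
  by rewrite indicE normrM ler_piMr//; case: (_ \in _); rewrite ?normr1 ?normr0.
rewrite ih big_ord_recr/=; congr (_ + _).
rewrite RintegralZl//; congr (_ * _).
rewrite /Rintegral integral_indic//; last exact: measurable_Nstar.
congr (fine (rho _)); exact: setIT.
Qed.

Lemma indic_fin_point i k :
  \1_([set fin_point i] : set (borel Nstar)) (fin_point k) = (i == k)%:R :> R.
Proof.
rewrite indicE; congr (nat_of_bool _)%:R; apply/idP/eqP => [|->]; last exact: mem_set.
by move/set_mem => /fin_point_inj.
Qed.

Lemma indic_fin_point_infty i : \1_([set fin_point i] : set (borel Nstar)) None = 0 :> R.
Proof. by rewrite indicE memNset. Qed.

Lemma sum_pick K (a : nat -> R) j :
  \sum_(i < K) a i * (i == j :> nat)%:R = if (j < K)%N then a j else 0.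
Proof.
case: ifPn => jK; last first.
  rewrite big1 // => i _; rewrite (_ : _ == _ = false) ?mulr0//.
  by apply: contraNF jK => /eqP <-.
rewrite (bigD1 (Ordinal jK)) //= eqxx mulr1 big1 ?addr0// => i ij.
by rewrite (_ : _ == _ = false) ?mulr0//; exact: negbTE ij.
Qed.

(** Beyond some [K] the function [h] is within [e] of its value at infinity, and
    a step function replaces it.  The rank [K] does not depend on the measure. *)
Lemma prob_Nstar_approx (h : Nstar -> R) e : continuous h -> 0 < e ->
  exists K, forall rho : probability (borel Nstar) R,
  `| \int[rho]_x h x - (h None + \sum_(k < K) (h (fin_point k) - h None) * mass rho k) | <= e.
Proof.
move=> ch e0.
have /cvgrPdist_le/(_ e e0)/nbhs_infty[_ [K hK]] := ch None.
exists K => rho.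
rewrite -(Rintegral_step rho (h None) (fun k => h (fin_point k) - h None) K).
pose g x := h None + \sum_(k < K)
  (h (fin_point k) - h None) * \1_([set fin_point k] : set (borel Nstar)) x.
have gfin k : g (fin_point k) = if (k < K)%N then h (fin_point k) else h None.
  rewrite /g; under eq_bigr do rewrite indic_fin_point.
  rewrite (sum_pick K (fun k => h (fin_point k) - h None)).
  by case: ifP; rewrite ?addr0// addrC subrK.
have g0 : g None = h None.
  by rewrite /g big1 ?addr0// => i _; rewrite indic_fin_point_infty mulr0.
have hg x : `|h x - g x| <= e.
  case: x => [m|]; last by rewrite g0 subrr normr0 ltW.
  rewrite fin_pointE gfin; case: ltnP => [_|Kk]; first by rewrite subrr normr0 ltW.
  by rewrite distrC; exact: hK.
have gi M : (forall x, `|g x| <= M) -> rho.-integrable setT (EFin \o g).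
  exact: bounded_integrable (measurable_fun_Nstar _).
have gb : exists M, forall x, `|g x| <= M.
  exists (`|h None| + \sum_(k < K) `|h (fin_point k)|) => -[m|]; last first.
    by rewrite g0 lerDl sumr_ge0.
  rewrite fin_pointE gfin; case: ifPn => kK; last by rewrite lerDl sumr_ge0.
  by rewrite (bigD1 (Ordinal kK))//= addrCA lerDl addr_ge0// sumr_ge0.
have [M gM] := gb.
have hM x : `|h x| <= e + M.
  rewrite -[h x](subrK (g x)) (le_trans (ler_normD _ _))// lerD//.
rewrite -RintegralB//; last 2 first.
- exact: bounded_integrable (measurable_fun_Nstar _) hM.
- exact: gi gM.
exact: (@le_norm_Rintegral _ _ _ rho (fun x => h x - g x) e (measurable_fun_Nstar _)).
Qed.

Lemma cvg_sumr (I : Type) (r : seq I) (f : I -> nat -> R) (l : I -> R) :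
  (forall i, f i n @[n --> \oo] --> l i) ->
  \sum_(i <- r) f i n @[n --> \oo] --> \sum_(i <- r) l i.
Proof.
move=> fl; elim: r => [|i r ih].
  rewrite big_nil (_ : (fun _ => _) = fun=> 0); first exact: cvg_cst.
  by apply/funext => n; rewrite big_nil.
rewrite big_cons (_ : (fun _ => _) = fun n => f i n + \sum_(j <- r) f j n).
  exact: cvgD.
by apply/funext => n; rewrite big_cons.
Qed.

Lemma weak_cvg_mass (rho_ : nat -> probability (borel Nstar) R) rho :
  (forall k, mass (rho_ n) k @[n --> \oo] --> mass rho k) -> weak_cvg rho_ rho.
Proof.
move=> mk h ch /bounded_funP[M hM].
have hE (r : probability (borel Nstar) R) :
    (\int[r]_x (h x)%:E)%E = (\int[r]_x h x)%:E.
  exact: integral_EFin (measurable_fun_Nstar _) hM.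
rewrite hE (_ : (fun n => _) = fun n => (\int[rho_ n]_x h x)%:E); last first.
  by apply/funext => n; exact: hE.
apply: cvg_EFin; first exact: nearW.
apply/cvgrPdist_le => e e0.
have [K hK] := prob_Nstar_approx ch (divr_gt0 e0 (ltr0n R 3)).
pose S (r : probability (borel Nstar) R) :=
  h None + \sum_(k < K) (h (fin_point k) - h None) * mass r k.
have : S (rho_ n) @[n --> \oo] --> S rho.
  apply: cvgD; first exact: cvg_cst.
  apply: cvg_sumr => k; apply: cvgMr; exact: mk.
move=> /cvgrPdist_le/(_ _ (divr_gt0 e0 (ltr0n R 3))); apply: filterS => n Sn /=.
have h1 := hK rho; have h2 := hK (rho_ n); rewrite -/(S _) in h1 h2.
rewrite (_ : _ - _ = (\int[rho]_x h x - S rho) + (S rho - S (rho_ n)) +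
  (S (rho_ n) - \int[rho_ n]_x h x)); last by ring.
rewrite (_ : e = e / 3 + e / 3 + e / 3); last by field.
rewrite (le_trans (ler_normD _ _))// lerD//; last by rewrite distrC.
by rewrite (le_trans (ler_normD _ _))// lerD.
Qed.

End Nstar.

(** * The limit law and its mixing measure *)

Section limit_law.
Variable R : realType.
Local Notation C := R[i].

Definition law_avg (d : nat) (f : C -> R) (m : Nstar) : R :=
  iter d (shift_avg (Defs.eta R m)) f 0.

Lemma law_avg_bounded d (f : C -> R) M m : continuous f ->
  (forall z, `|f z| <= M) -> `|law_avg d f m| <= M.
Proof.
move=> cf fM; have mf := continuous_borel_measurable cf.
exact: (iter_shift_avg_bounded _ _ mf fM).2.
Qed.

Lemma continuous_law_avg d (f : C -> R) M : continuous f ->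
  (forall z, `|f z| <= M) -> continuous (law_avg d f).
Proof.
move=> cf fM; apply: continuous_Nstar.
exact: (@iter_shift_avg_cvg R f M d (fun=> 0) 0 cf fM (@cvg_cst _ _ _ _ _)).
Qed.

Lemma integral_conv_eta d (f : C -> R) M m : continuous f ->
  (forall z, `|f z| <= M) ->
  (\int[conv_pow (Defs.eta R m) d]_z (f z)%:E)%E = (law_avg d f m)%:E.
Proof.
move=> cf fM; have mf := continuous_borel_measurable cf.
exact: integral_conv_pow mf fM.
Qed.

(** Both sides equal the series of the [rho]-masses times the values of
    [law_avg d f], the left one because [limit_law] is a countable sum of scaled
    measures. *)
Lemma limit_law_integral_ge0 (rho : probability (borel Nstar) R) d (f : C -> R) M :
  continuous f -> (forall z, 0 <= f z) -> (forall z, `|f z| <= M) ->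
  (\int[limit_law rho d]_z (f z)%:E)%E = (\int[rho]_m (law_avg d f m)%:E)%E.
Proof.
move=> cf f0 fM; have mf := continuous_borel_measurable cf.
have F0 m : 0 <= law_avg d f m.
  rewrite -lee_fin -(integral_conv_eta d m cf fM).
  by apply: integral_ge0 => z _; rewrite lee_fin.
pose w k : {nonneg R} :=
  NngNum (fine_ge0 (measure_ge0 rho ([set enumN k] : set (borel Nstar)))).
have wE k : rho [set enumN k] = ((w k)%:num)%:E.
  by rewrite /w/= fineK// fin_num_measure//; exact: measurable_Nstar.
pose mu : {measure set (borel C) -> \bar R} :=
  mseries (fun k => mscale (w k) (conv_pow (Defs.eta R (enumN k)) d)) 0.
have bijN : set_bij [set: nat] [set: Nstar] enumN.
  split => //; first by move=> i j _ _; exact: enumN_inj.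
  by move=> x _; have [k <-] := enumN_surj x; exists k.
transitivity (\int[mu]_z (f z)%:E)%E.
  apply: eq_measure_integral => A _ _.
  rewrite /= /limit_law (@reindex_esum R _ _ _ _ _ _ bijN).
  rewrite /mu/= /mseries/= nneseries_esumT//.
  by apply: eq_esum => k _; rewrite wE.
have mfE : measurable_fun [set: borel C] (EFin \o f : borel C -> \bar R).
  exact/measurable_EFinP.
rewrite /mu ge0_integral_measure_series//; last by move=> z _; rewrite lee_fin.
transitivity (\sum_(k <oo) ((w k)%:num * law_avg d f (enumN k))%:E)%E.
  apply: eq_eseriesr => k _; rewrite ge0_integral_mscale//=; last by move=> z _; rewrite lee_fin.
  by rewrite (integral_conv_eta d _ cf fM).
have NT : [set: borel Nstar] = \bigcup_k [set enumN k].
  by apply/seteqP; split => // x _; have [k <-] := enumN_surj x; exists k.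
rewrite NT ge0_integral_bigcup//.
- apply: eq_eseriesr => k _.
  rewrite (eq_integral (fun=> (law_avg d f (enumN k))%:E)); last first.
    by move=> x; rewrite inE => ->.
  rewrite integral_cst//; last exact: measurable_Nstar.
  apply: esym; apply: etrans (congr1 (mule (law_avg d f (enumN k))%:E) (wE k)) _.
  by rewrite -EFinM mulrC.
- by move=> k; exact: measurable_Nstar.
- by move=> _ B mB; exact: measurable_Nstar.
- by move=> x _; rewrite lee_fin.
- by move=> i j _ _ [x [-> /esym/enumN_inj]].
Qed.

(** Adding the bound of [f] reduces the claim to nonnegative functions. *)
Lemma limit_law_integral (rho : probability (borel Nstar) R) d (f : C -> R) M :
  continuous f -> (forall z, `|f z| <= M) ->
  (\int[limit_law rho d]_z (f z)%:E)%E = (\int[rho]_m (law_avg d f m)%:E)%E.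
Proof.
move=> cf fM; have mf := continuous_borel_measurable cf.
pose g z := f z + M.
have cg : continuous g by move=> z; exact: (cvgD (cf z) (cvg_cst M)).
have g0 z : 0 <= g z.
  by have := fM z; rewrite ler_norml => /andP[h _]; rewrite /g -lerBlDr sub0r.
have gM z : `|g z| <= M + `|M| by rewrite (le_trans (ler_normD _ _))// lerD.
have mg := continuous_borel_measurable cg.
have shift d' (T : measurableType d') (P : probability T R) (h : T -> R) :
    measurable_fun setT h -> (forall x, `|h x| <= M) ->
    \int[P]_x (h x + M) = \int[P]_x h x + M.
  move=> mh hM; rewrite RintegralD//; last 2 first.
  - exact: bounded_integrable mh hM.
  - by apply: (@bounded_integrable _ _ _ P (fun=> M) `|M|).
  by rewrite Rintegral_prob_cst.
have Fg m : law_avg d g m = law_avg d f m + M.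
  apply: EFin_inj; rewrite -(integral_conv_eta d m cg gM).
  rewrite (integral_EFin _ mg gM) shift//; congr (_ + _)%:E.
  by rewrite /Rintegral (integral_conv_eta d m cf fM).
have := limit_law_integral_ge0 rho d cg g0 gM.
have Fm : measurable_fun setT (law_avg d f : borel Nstar -> R).
  exact: measurable_fun_Nstar.
have FM m := law_avg_bounded d m cf fM.
rewrite (eq_integral (fun m : borel Nstar => (law_avg d f m + M)%:E)); last by move=> m _; rewrite Fg.
rewrite (integral_EFin _ mg gM) shift//.
rewrite (@integral_EFin _ _ _ rho (fun m => law_avg d f m + M) (M + `|M|)); last 2 first.
- exact: measurable_fun_Nstar.
- by move=> m; rewrite (le_trans (ler_normD _ _))// lerD.
rewrite (@shift _ _ rho)//.
move=> [/addIr e]; rewrite (integral_EFin _ mf fM) e.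
by rewrite (integral_EFin _ Fm FM).
Qed.

End limit_law.

Section prescribed_masses.
Variables (R : realType) (p : nat -> R).
Hypothesis p0 : forall k, 0 <= p k.
Hypothesis p1 : forall K, \sum_(k < K) p k <= 1.

(** The missing mass, 1 minus the sum of the [p k], is placed at infinity. *)
Lemma exists_prob_mass : exists rho : probability (borel Nstar) R,
  forall k, mass rho k = p k.
Proof.
have pcvg : cvgn (series p).
  apply: nondecreasing_is_cvgn.
    by apply/nondecreasing_seqP => n; rewrite -subr_ge0 seriesSB.
  by exists 1 => _ [n _ <-]; rewrite /series/= big_mkord.
have plim : limn (series p) <= 1.
  by apply: limr_le => //; apply: nearW => n; rewrite /series/= big_mkord.
have q0 : 0 <= 1 - limn (series p) by rewrite subr_ge0.
pose q k : {nonneg R} := if k is k'.+1 then NngNum (p0 k') else NngNum q0.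
pose mu : {measure set (borel Nstar) -> \bar R} :=
  mseries (fun k => mscale (q k) (\d_(enumN k : borel Nstar))) 0.
have mu1 : mu setT = 1%E.
  rewrite /mu/= /mseries.
  rewrite (_ : (fun n => _) = fun n => (\sum_(0 <= k < n) (q k)%:num)%:E); last first.
    apply/funext => n; rewrite -sumEFin; apply: eq_bigr => k _.
    change (((q k)%:num)%:E * \d_(enumN k : borel Nstar) setT = ((q k)%:num)%:E)%E.
    by rewrite diracT mule1.
  apply/cvg_lim => //; apply: cvg_EFin; first exact: nearW.
  rewrite -cvg_shiftS /=.
  rewrite (_ : (fun n => _) = fun n => (1 - limn (series p)) + series p n); last first.
    by apply/funext => n; rewrite /= big_nat_recl// /series /=.
  have := cvgD (cvg_cst (1 - limn (series p))) pcvg.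
  by rewrite subrK; apply.
pose isP := Measure_isProbability.Build _ _ _ mu mu1.
pose rho : probability (borel Nstar) R :=
  HB.pack_for (Probability.type (borel Nstar) R) (Measure.sort mu) isP.
exists rho => k.
have -> : mass rho k = fine (mu [set fin_point k]) by [].
suff -> : mu [set fin_point k] = (p k)%:E by [].
rewrite /mu/= /mseries.
apply/cvg_lim => //; apply: cvg_near_cst.
exists k.+2 => // n /= kn.
rewrite (_ : n = k.+2 + (n - k.+2))%N; last by rewrite subnKC.
have term i : mscale (q i) \d_(enumN i : borel Nstar) [set fin_point k] =
    ((q i)%:num * (i == k.+1)%:R)%:E.
  change (((q i)%:num)%:E * \d_(enumN i : borel Nstar) [set fin_point k] =
    ((q i)%:num * (i == k.+1)%:R)%:E)%E.
  rewrite diracE EFinM; congr (_ * (nat_of_bool _)%:R%:E)%E.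
  apply/idP/eqP => [/set_mem|->]; last exact: mem_set.
  by rewrite -[fin_point k]/(enumN k.+1) => /enumN_inj.
rewrite (eq_bigr _ (fun i _ => term i)) sumEFin; congr (_%:E).
rewrite big_mkord; have kn' : (k.+1 < k.+2 + (n - k.+2))%N by rewrite leq_addr.
rewrite (bigD1 (Ordinal kn')) //= eqxx mulr1 big1 ?addr0// => i ik.
by rewrite (_ : _ == _ = false) ?mulr0//; exact: negbTE ik.
Qed.

End prescribed_masses.

(** * Random circulant matrices *)

Section circulant_spectrum.
Variables (R : realType) (G : finZmodType).
Local Notation C := R[i].

Lemma card_finZmod_gt0 : (0 < #|G|)%N.
Proof. by apply/card_gt0P; exists 0. Qed.

Definition set_circulant (S : {set G}) : 'M[C]_#|G| :=
  \matrix_(i, j) (enum_val i - enum_val j \in S)%:R.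

Lemma set_circulant_inj : injective set_circulant.
Proof.
move=> S S' /matrixP SS'; apply/setP => s.
have := SS' (enum_rank s) (enum_rank 0); rewrite !mxE !enum_rankK subr0.
by move/eqP; rewrite eqr_nat; do 2 case: (_ \in _).
Qed.

(** A circulant matrix with entries 0 and 1 is given by the set on which its
    generating function is 1, and the row and column counts are the cardinal of
    that set. *)
Lemma MatE d : @Mat R G d =
  [set set_circulant S | S in [set` [set S : {set G} | #|S| == d]%SET]].
Proof.
have card_pre (S : {set G}) (phi : 'I_#|G| -> G) : bijective phi ->
    #|[set i | phi i \in S]%SET| = #|S|.
  move=> phiB; rewrite -[RHS](@on_card_preimset _ _ phi S); last exact: onW_bij.
  by apply: eq_card => i; rewrite !inE.
have bl (x : G) : bijective (fun i : 'I_#|G| => enum_val i - x).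
  apply: (@bij_comp _ _ _ (fun y : G => y - x)); last exact: enum_val_bij.
  by exists (fun y => y + x) => y; rewrite ?subrK ?addrK.
have br (x : G) : bijective (fun i : 'I_#|G| => x - enum_val i).
  apply: (@bij_comp _ _ _ (fun y : G => x - y)); last exact: enum_val_bij.
  by exists (fun y => x - y) => y; rewrite subKr.
apply/seteqP; split => [A [[a Aa] A01 _ colA]|_ [S /= Sd <-]].
  pose S := [set s | a s == 1]%SET.
  exists S; last first.
    apply/matrixP => i j; rewrite mxE inE -Aa.
    by case: (A01 i j) => ->; rewrite ?eqxx// eq_sym oner_eq0.
  rewrite /= inE -(card_pre S _ (bl (enum_val (enum_rank (0 : G))))).
  rewrite -(colA (enum_rank 0)); apply/eqP; apply: eq_card => i.
  by rewrite !inE Aa.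
move: Sd; rewrite inE => /eqP Sd.
have c1 i j : (set_circulant S i j == 1) = (enum_val i - enum_val j \in S).
  by rewrite mxE; case: (_ \in _); rewrite ?eqxx// eq_sym oner_eq0.
split.
- by exists (fun s => (s \in S)%:R) => i j; rewrite mxE.
- by move=> i j; rewrite mxE; case: (_ \in _); [right|left].
- move=> i; rewrite -Sd -(card_pre S _ (br (enum_val i))).
  by apply: eq_card => j; rewrite !inE c1.
- move=> j; rewrite -Sd -(card_pre S _ (bl (enum_val j))).
  by apply: eq_card => i; rewrite !inE c1.
Qed.

Variable b : G -> G -> C.
Hypothesis bC : forall x y, b x y = b y x.
Hypothesis bDl : forall x x' y, b (x + x') y = b x y * b x' y.
Hypothesis b0l : forall y, b 0 y = 1.
Hypothesis bnd : forall x, (forall y, b x y = 1) -> x = 0.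

Lemma eigenvalues_set_circulant (S : {set G}) :
  perm_eq (eigenvalues (set_circulant S)) [seq \sum_(s in S) b x s | x <- enum G].
Proof.
have cp := @char_poly_circulant R G b bC bDl b0l bnd (set_circulant S)
  (fun s => (s \in S)%:R) (fun i j => mxE _ _ _ _).
apply: prod_XsubC_eq.
rewrite big_map big_enum /=.
transitivity (char_poly (set_circulant S)).
  rewrite /eigenvalues; case: closed_field_poly_normal => r /= rE.
  by rewrite [RHS]rE (monicP (char_poly_monic _)) scale1r.
rewrite cp; apply: eq_bigr => x _; congr ('X - _%:P).
rewrite [RHS]big_mkcond; apply: eq_bigr => s _.
by case: (_ \in _); rewrite ?mul1r ?mul0r.
Qed.

Lemma integral_esd_set_circulant (S : {set G}) (f : C -> R) :
  measurable_fun [set: borel C] (f : borel C -> R) ->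
  (\int[esd (set_circulant S)]_z (f z)%:E)%E =
  (#|G|%:R^-1 * \sum_x f (\sum_(s in S) b x s))%:E.
Proof.
move=> mf; rewrite [LHS](integral_empirical (eigenvalues (set_circulant S) : seq (borel C)) mf).
rewrite size_eigenvalues (perm_big _ (eigenvalues_set_circulant S)) /= big_map big_enum /=.
by [].
Qed.

Lemma iter_avg_tuple d (v : G -> C) (f : C -> R) z :
  iter d (fun g w => #|G|%:R^-1 * \sum_y g (v y + w)) f z =
  (#|G| ^ d)%:R^-1 * \sum_(t : d.-tuple G) f (\sum_(y <- t) v y + z).
Proof.
elim: d z => [|d ih] z.
  rewrite expn0 invr1 mul1r (big_pred1 [tuple]) ?big_nil ?add0r// => t.
  by apply/esym/eqP/val_inj; case: t => -[].
rewrite big_tupleS /= expnS natrM invfM -mulrA; congr (_ * _).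
rewrite mulr_sumr; apply: eq_bigr => y _; rewrite ih; congr (_ * _).
by apply: eq_bigr => t _; rewrite big_cons -addrA addrCA.
Qed.

(** Independent uniform points of [G] are mapped by the character [b x] to
    independent uniform roots of unity of order [#[x]]. *)
Lemma law_avg_order d (f : C -> R) M x : continuous f -> (forall z, `|f z| <= M) ->
  law_avg d f (Some (exist _ #[x]%g (order_gt0 x) : posnat)) =
  (#|G| ^ d)%:R^-1 * \sum_(t : d.-tuple G) f (\sum_(y <- t) b x y).
Proof.
move=> cf fM; have mf := continuous_borel_measurable cf.
transitivity (iter d (fun g w => #|G|%:R^-1 * \sum_y g (b x y + w)) f 0); last first.
  by rewrite iter_avg_tuple; under eq_bigr do rewrite addr0.
rewrite /law_avg; elim: d 0 => //= d ih z.
rewrite shift_avg_roots; last exact: (iter_shift_avg_bounded _ _ mf fM).1.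
rewrite -(sum_comp_bicharacter bC bDl b0l bnd x (fun u => iter d _ f (u + z))).
by congr (_ * _); apply: eq_bigr => y _; rewrite ih.
Qed.

Lemma integral_ord_law (h : Nstar -> R) :
  (\int[ord_law R G]_m (h m)%:E)%E =
  (#|G|%:R^-1 * \sum_(x : G) h (Some (exist _ #[x]%g (order_gt0 x) : posnat)))%:E.
Proof.
have mh : measurable_fun setT (h : borel Nstar -> R) by exact: measurable_fun_Nstar.
rewrite [LHS](integral_empirical _ mh) size_map -cardE.
by rewrite big_map big_enum.
Qed.

(** For each [x] separately the two averages are compared by [sampling_dist],
    and the bound survives the average over [x]. *)
Lemma expected_esd_dist d (disp : measure_display) (Omega : measurableType disp)
    (P : probability Omega R) (X : Omega -> 'M[C]_#|G|) (f : C -> R) M :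
  (d <= #|G|)%N -> uniform_on P X (@Mat R G d) ->
  continuous f -> (forall z, `|f z| <= M) ->
  exists2 E : R, (\int[P]_w \int[esd (X w)]_z (f z)%:E)%E = E%:E &
   `|E - \int[ord_law R G]_m law_avg d f m| <= 2 * M * ((d ^ 2)%:R / #|G|%:R).
Proof.
move=> dG Xu cf fM; have mf := continuous_borel_measurable cf.
have fE (A : 'M[C]_#|G|) : (\int[esd A]_z (f z)%:E)%E = (\int[esd A]_z f z)%:E.
  exact: integral_EFin mf fM.
pose h (A : 'M[C]_#|G|) : R := \int[esd A]_z f z.
have Xu' : uniform_on P X
    [set set_circulant S | S in [set` [set S : {set G} | #|S| == d]%SET]].
  by rewrite -MatE.
have [_ XE] := @integral_uniform_on _ _ R P _ _ _ set_circulant X h set_circulant_inj Xu'.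
exists (#|[set S : {set G} | #|S| == d]%SET|%:R^-1 *
    \sum_(S in [set S : {set G} | #|S| == d]%SET) h (set_circulant S)).
  by rewrite -[RHS]XE; apply: eq_integral => w _; exact: fE.
have -> : \int[ord_law R G]_m law_avg d f m = #|G|%:R^-1 * \sum_(x : G)
    law_avg d f (Some (exist _ #[x]%g (order_gt0 x) : posnat)).
  by rewrite /Rintegral [X in fine X]integral_ord_law.
rewrite (eq_bigr (fun S : {set G} => #|G|%:R^-1 * \sum_x f (\sum_(s in S) b x s))); last first.
  by move=> S _; rewrite /h /Rintegral [X in fine X](integral_esd_set_circulant S mf).
rewrite -mulr_sumr mulrCA -mulrBr exchange_big /= mulr_sumr -sumrB.
rewrite normrM normfV normr_nat.
rewrite ler_pdivrMl ?ltr0n ?card_finZmod_gt0//.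
apply: (le_trans (ler_norm_sum _ _ _)).
apply: (@le_trans _ _ (\sum_(x : G) 2 * M * ((d ^ 2)%:R / #|G|%:R))); last first.
  by rewrite sumr_const -[X in X <= _]mulr_natl.
apply: ler_sum => x _; rewrite (law_avg_order d x cf fM).
have := @sampling_dist R G d (fun s => f (\sum_(y <- s) b x y)) M
  card_finZmod_gt0 dG (fun s => fM _).
have -> : \sum_(S in [set S : {set G} | #|S| == d]%SET) f (\sum_(s in S) b x s) =
    \sum_(S in [set S : {set G} | #|S| == d]%SET) f (\sum_(y <- enum S) b x y).
  by apply: eq_bigr => S _; rewrite big_enum.
by apply => s t st; congr (f _); exact: perm_big.
Qed.

End circulant_spectrum.

(** * Power test functions *)

Section power_test.
Variable R : realType.
Local Notation C := R[i].

Definition clip (B x : R) : R := Num.max (- B) (Num.min B x).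

Lemma clip_id B x : `|x| <= B -> clip B x = x.
Proof.
rewrite ler_norml => /andP[h1 h2].
by rewrite /clip (min_idPr h2) (max_idPr h1).
Qed.

Lemma clip_bounded B x : 0 <= B -> `|clip B x| <= B.
Proof.
move=> B0; rewrite ler_norml /clip le_max lexx/= ge_max ge_min lexx orTb andbT.
by rewrite (le_trans _ B0)// oppr_le0.
Qed.

Lemma continuous_clip B : continuous (clip B).
Proof.
move=> x; apply: (@continuous_max R R (fun=> - B) (fun x => Num.min B x)).
  exact: cvg_cst.
apply: (@continuous_min R R (fun=> B) id); [exact: cvg_cst|exact: cvg_id].
Qed.

Variable d : nat.

(** The threshold [d ^ k] bounds [z ^ k] on the disc of radius [d], which carries
    the laws of sums of [d] roots of unity, so that clipping is invisible there. *)
Definition power_test (k : nat) (z : C) : R := clip ((d ^ k)%:R) (complex.Re (z ^+ k)).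

Lemma power_test_bounded k z : `|power_test k z| <= (d ^ k)%:R.
Proof. exact: clip_bounded. Qed.

Lemma continuous_power_test k : continuous (power_test k).
Proof.
move=> z; apply: (@continuous_comp _ _ _ (fun z : C => complex.Re (z ^+ k)) (clip _)).
  apply: (@continuous_comp _ _ _ (fun z : C => z ^+ k) (fun z : C => complex.Re z)).
    elim: k => [|k ih].
      rewrite (_ : (fun _ => _) = fun=> 1); first exact: cst_continuous.
      by apply/funext => w; rewrite expr0.
    rewrite (_ : (fun _ => _) = fun w : C => w * w ^+ k).
      refine (@continuousM _ _ (fun w : C => w) (fun w : C => w ^+ k) z _ ih).
      by move=> A; exact.
    by apply/funext => w; rewrite exprS.
  exact: continuous_Re.
exact: continuous_clip.
Qed.

(** The sums of [d] roots of unity stay where the clipping does nothing. *)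
Lemma law_avg_power (m : posnat) k :
  law_avg d (power_test k) (Some m) = complex.Re (moment R (sval m) d k).
Proof.
apply: (@iter_shift_avg_Re R (sval m) m d 0) => //.
- exact: continuous_power_test.
- by exists (d ^ k)%:R => z; exact: power_test_bounded.
- move=> z; rewrite add0n => zd; rewrite /power_test clip_id//.
  rewrite -lecR (le_trans (normc_ge_Re _))//.
  rewrite normrX natrX rmorphXn rmorph_nat.
  by rewrite lerXn2r ?nnegrE.
- by rewrite normr0.
Qed.

(** An order exceeding [k] does not divide [k], so its moment vanishes and the
    sum stops at [k]. *)
Lemma integral_power_ord_law (G : finZmodType) k : (0 < k)%N ->
  \int[ord_law R G]_m law_avg d (power_test k) m =
  \sum_(j < k) complex.Re (moment R j.+1 d k) * mass (ord_law R G) j.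
Proof.
move=> k0.
rewrite -[RHS]add0r -(Rintegral_step (ord_law R G) 0 (fun j => complex.Re (moment R j.+1 d k))).
rewrite /Rintegral !integral_ord_law /=; congr (_ * _); apply: eq_bigr => x _.
rewrite law_avg_power /= add0r; set o := #[x]%g.
have o0 : (0 < o)%N := order_gt0 x.
rewrite fin_pointE /=.
under eq_bigr do rewrite indic_fin_point.
rewrite (sum_pick k (fun j => complex.Re (moment R j.+1 d k))) prednK//.
case: leqP => // ko; rewrite moment_ndvd ?gtnNdvd//.
Qed.

End power_test.

(** * Convergence of the spectral distributions *)

(** The system of [integral_power_ord_law] is triangular with diagonal
    coefficient [d], hence can be solved for the masses one after the other. *)
Lemma cvg_mass_of_power_tests (R : realType) (d : nat) (G : nat -> finZmodType) :
  (0 < d)%N ->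
  (forall k, (0 < k)%N ->
     cvgn (fun n => \int[ord_law R (G n)]_m law_avg d (@power_test R d k) m)) ->
  forall k, cvgn (fun n => mass (ord_law R (G n)) k).
Proof.
move=> d0 Icvg k; have [K] := ubnP k; elim: K k => // K ih k; rewrite ltnS => kK.
pose a j : R := complex.Re (moment R j.+1 d k.+1).
have ak : a k = d%:R.
  by rewrite /a moment_order// -(rmorph_nat (real_complex R)).
have -> : (fun n => mass (ord_law R (G n)) k) = fun n =>
    (\int[ord_law R (G n)]_m law_avg d (@power_test R d k.+1) m -
      \sum_(j < k) a j * mass (ord_law R (G n)) j) * d%:R^-1.
  apply/funext => n; rewrite integral_power_ord_law// big_ord_recr /= -/(a k) ak.
  by rewrite addrC addrK mulrC mulKf// pnatr_eq0 -lt0n.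
have cS : (fun n => \sum_(j < k) a j * mass (ord_law R (G n)) j) @ \oo -->
    \sum_(j < k) a j * limn (fun n => mass (ord_law R (G n)) j).
  apply: cvg_sumr => j; apply: cvgMr.
  by apply: ih; exact: leq_trans (ltn_ord j) kK.
apply: cvgP; apply: cvgMl; apply: cvgB; last exact: cS.
exact: (Icvg k.+1 isT).
Qed.

Theorem theorem1p2 (R : realType) (d : nat) (d_gt0 : (0 < d)%N)
    (G : nat -> finZmodType)
    (card_G : #|G n| @[n --> \oo] --> \oo)
    (disp : nat -> measure_display)
    (Omega : forall n, measurableType (disp n))
    (P : forall n, probability (Omega n) R)
    (C : forall n, Omega n -> 'M[R[i]]_#|G n|)
    (C_uniform : forall n, (d <= #|G n|)%N ->
       uniform_on (P n) (@C n) (@Mat R (G n) d)) :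
  ((exists mu : probability (borel R[i]) R,
      weak_cvg_in_expectation P (fun n w => esd (C n w)) mu) ->
   exists rho : probability (borel Nstar) R,
     weak_cvg (fun n => ord_law R (G n)) rho) /\
  (forall rho : probability (borel Nstar) R,
     weak_cvg (fun n => ord_law R (G n)) rho ->
     weak_cvg_in_expectation P (fun n w => esd (C n w)) (limit_law rho d)).
Proof.
pose I f n := \int[ord_law R (G n)]_m law_avg d f m.
pose E f n := (\int[P n]_w \int[esd (C n w)]_z (f z)%:E)%E.
have dN : \forall n \near \oo, (d <= #|G n|)%N.
  exact: (card_G _ (nbhs_infty_ge d)).
have near_E f M : continuous f -> (forall z, `|f z| <= M) ->
    \forall n \near \oo, E f n \is a fin_num /\
      `|fine (E f n) - I f n| <= 2 * M * ((d ^ 2)%:R / #|G n|%:R).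
  move=> cf fM; apply: filterS dN => n dGn.
  have [b [bC bD b0 bnd]] := exists_bicharacter R (G n).
  have [e Ee eI] := expected_esd_dist bC bD b0 bnd dGn (C_uniform n dGn) cf fM.
  by rewrite /E Ee.
have invN : (#|G n|%:R)^-1 @[n --> \oo] --> (0 : R).
  have h : (k%:R)^-1 @[k --> \oo] --> (0 : R).
    by rewrite -cvg_shiftS; exact: cvg_harmonic.
  exact: (cvg_comp _ _ card_G h).
have diff0 f M : continuous f -> (forall z, `|f z| <= M) ->
    fine (E f n) - I f n @[n --> \oo] --> 0.
  move=> cf fM; apply/cvgrPdist_le => e e0.
  have : 2 * M * ((d ^ 2)%:R / #|G n|%:R) @[n --> \oo] --> 2 * M * ((d ^ 2)%:R * (0 : R)).
    by apply: cvgMr; apply: cvgMr.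
  rewrite !mulr0.
  move=> /cvgrPdist_le/(_ e e0).
  apply: filterS2 (near_E f M cf fM) => n [_ h1] h2.
  rewrite sub0r normrN; apply: le_trans h1 _; apply: le_trans h2.
  by rewrite sub0r normrN ler_norm.
split=> [[mu mucvg]|rho rhocvg f cf /bounded_funP[M fM]]; last first.
  rewrite (limit_law_integral rho d cf fM).
  have cF := @continuous_law_avg R d f M cf fM.
  have FM m := law_avg_bounded d m cf fM.
  have FE (r : probability (borel Nstar) R) :
      (\int[r]_m (law_avg d f m)%:E)%E = (\int[r]_m law_avg d f m)%:E.
    exact: integral_EFin (measurable_fun_Nstar _) FM.
  have := rhocvg _ cF ((bounded_funP _).2 (ex_intro _ M FM)).
  rewrite FE => /fine_cvgP[_ Icvg].
  apply/fine_cvgP; split; first by apply: filterS (near_E f M cf fM) => n [].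
  have -> : fine \o (fun n => E f n) = fun n => (fine (E f n) - I f n) + I f n.
    by apply/funext => n /=; rewrite subrK.
  rewrite -[X in _ --> X]add0r; exact: (cvgD (diff0 f M cf fM) Icvg).
have Icvg f M : continuous f -> (forall z, `|f z| <= M) -> cvgn (I f).
  move=> cf fM; have mf := continuous_borel_measurable cf.
  have := mucvg f cf ((bounded_funP _).2 (ex_intro _ M fM)).
  rewrite (integral_EFin _ mf fM) => /fine_cvgP[_ Ecvg].
  apply/cvg_ex; exists (\int[mu]_z f z).
  have -> : I f = fun n => fine (E f n) - (fine (E f n) - I f n).
    by apply/funext => n; rewrite opprB addrC subrK.
  rewrite -[X in _ --> X]subr0; exact: (cvgB Ecvg (diff0 f M cf fM)).
have mcvg : forall k, cvgn (fun n => mass (ord_law R (G n)) k).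
  apply: (@cvg_mass_of_power_tests R d) => // k _.
  exact: Icvg (@continuous_power_test R d k) (@power_test_bounded R d k).
pose p k := limn (fun n => mass (ord_law R (G n)) k).
have p0 k : 0 <= p k.
  by apply: limr_ge => //; apply: nearW => n; exact: fine_ge0.
have p1 K : \sum_(k < K) p k <= 1.
  (* partial sums of the limit masses are limits of partial sums, each at most 1 *)
  have sK : (fun n => \sum_(k < K) mass (ord_law R (G n)) k) @ \oo --> \sum_(k < K) p k.
    by apply: cvg_sumr => k; exact: mcvg.
  rewrite -(cvg_lim _ sK)//; apply: limr_le; first exact: cvgP sK.
  apply: nearW => n.
  have -> : \sum_(k < K) mass (ord_law R (G n)) k = 0 + \sum_(k < K) 1 * mass (ord_law R (G n)) k.
    by rewrite add0r; apply: eq_bigr => k _; rewrite mul1r.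
  rewrite -(Rintegral_step (ord_law R (G n)) 0 (fun=> 1) K).
  rewrite /Rintegral integral_ord_law /= -[leRHS](@mulVf _ #|G n|%:R); last first.
    by rewrite pnatr_eq0 -lt0n card_finZmod_gt0.
  rewrite ler_wpM2l ?invr_ge0// -sum1_card natr_sum; apply: ler_sum => x _.
  rewrite add0r fin_pointE; under eq_bigr do rewrite indic_fin_point.
  by rewrite (sum_pick _ (fun=> 1)); case: ifP.
have [rho rhop] := exists_prob_mass p0 p1.
exists rho; apply: weak_cvg_mass => k; rewrite rhop.
exact: mcvg.
Qed.
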